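(* Consider the conditionally Gaussian model of the context (with $\psi$ bounded). Let $K,N\ge1$, fix observations $Y_K=(y_1,\dots,y_K)$, and let $\widehat\mu_k^N$, $\mu_k^N$ be the weighted and the resampled measures of the optimal particle filter with $N$ particles. Then, with $\kappa=\kappa(Y_K)$ given by $$\kappa^{-1}=\exp\Bigl(\max_{0\le j\le K-1}|y_{j+1}|_S^2+\sup_{v\in\mathcal{X}}|H\psi(v)|_S^2\Bigr),$$ we have $$d(\widehat\mu_K^N,\mu_K)\ \le\ \sum_{k=1}^K(2\kappa^{-2})^kN^{-1/2}\qquad\text{and}\qquad d(\mu_K^N,\mu_K)\ \le\ \sum_{k=0}^K(2\kappa^{-2})^kN^{-1/2},$$ where $\mu_K$ is the filtering distribution.
   Context: $\mathcal{X}$, $\mathcal{Y}$ are finite-dimensional Euclidean spaces and $\mathcal{M}(\mathcal{X})$ is the set of probability measures on $\mathcal{X}$. For symmetric positive definite $A$, $|\cdot|_A=|A^{-1/2}\cdot|$. Model. $\psi:\mathcal{X}\to\mathcal{X}$ is bounded (and measurable), $H:\mathcal{X}\to\mathcal{Y}$ is linear, and $$u_{k+1}=\psi(u_k)+\xi_k,\qquad y_{k+1}=Hu_{k+1}+\eta_{k+1},$$ with $u_0\sim\mu_0\in\mathcal{M}(\mathcal{X})$, $\xi_k\sim N(0,\Sigma)$ i.i.d., $\eta_k\sim N(0,\Gamma)$ i.i.d., and $u_0,\{\xi_k\},\{\eta_k\}$ independent; $\Sigma=\sigma^2\Sigma_0$, $\Gamma=\gamma^2\Gamma_0$ with $\Sigma_0,\Gamma_0$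 strictly positive definite and $\sigma,\gamma\in(0,\infty)$. Set $C^{-1}=\Sigma^{-1}+H^*\Gamma^{-1}H$, $S=H\Sigma H^*+\Gamma$, $K_{\rm gain}=\Sigma H^*S^{-1}$ (the Kalman gain). The filtering distribution $\mu_k$ is the conditional law of $u_k$ given $Y_k=(y_1,\dots,y_k)$. Optimal particle filter (OPF). Initialize $u_0^{(n)}\sim\mu_0$ i.i.d., $n=1,\dots,N$, and for $k\ge0$: draw $\widehat u_{k+1}^{(n)}=(I-K_{\rm gain}H)\psi(u_k^{(n)})+K_{\rm gain}y_{k+1}+\zeta_k^{(n)}$ with $\zeta_k^{(n)}\sim N(0,C)$ i.i.d.; set $$w_{k+1}^{(n),*}=\exp\bigl(-\tfrac12|y_{k+1}-H\psi(u_k^{(n)})|_S^2\bigr),\qquad w_{k+1}^{(n)}=\frac{w_{k+1}^{(n),*}}{\sum_{m=1}^Nw_{k+1}^{(m),*}};$$ draw $u_{k+1}^{(n)}$, $n=1,\dots,N$, independently from $\{\widehat u_{k+1}^{(m)}\}_{m=1}^N$ with weights $\{w_{k+1}^{(m)}\}_{m=1}^N$. Define $$\mu_k^N=\frac1N\sum_{n=1}^N\delta_{u_k^{(n)}},\qquad \widehat\mu_k^N=\sum_{n=1}^Nw_k^{(n)}\delta_{\widehat u_k^{(n)}}\ (k\ge1),\qquad\widehat\mu_0^N=\mu_0.$$ Metric. For random elements $\mu,\nu$ of $\mathcal{M}(\mathcal{X})$, $d(\mu,\nu)=\sup_{|f|_\infty\le1}\sqrt{\mathbb{E}^\omega|\mu(f)-\nu(f)|^2}$,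 where the supremum is over measurable $f:\mathcal{X}\to\mathbb{R}$ bounded by $1$ and $\mathbb{E}^\omega$ is expectation over the randomness of the algorithm (the observations being fixed). *)

(* Defs.v *)
From HB Require Import structures.
From mathcomp Require Import all_boot all_order all_algebra.
From mathcomp Require Import all_classical all_reals all_analysis.
Set Implicit Arguments.
Unset Strict Implicit.
Unset Printing Implicit Defensive.
Import Order.TTheory GRing.Theory Num.Theory.
Import numFieldNormedType.Exports.
Local Open Scope classical_set_scope.
Local Open Scope ring_scope.

(* The Euclidean spaces X and Y are the spaces of column vectors 'cV[R]_p and
   'cV[R]_q; the adjoint H^* is the transpose.  Matrices carry the sigma-algebra
   generated by their entries (for real entries, the Borel sigma-algebra). *)
Section mx_measurable.
Context {d} {T : measurableType d} {m n : nat}.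

Definition mx_entry_sets : set (set 'M[T]_(m, n)) :=
  [set E | exists ij B, measurable B /\ E = (fun A : 'M[T]_(m, n) => A ij.1 ij.2) @^-1` B].

Let mx_set0 : <<s mx_entry_sets >> set0.
Proof. exact: sigma_algebra0. Qed.

Let mx_setC A : <<s mx_entry_sets >> A -> <<s mx_entry_sets >> (~` A).
Proof. by move=> ?; rewrite -setTD; exact: sigma_algebraCD. Qed.

Let mx_bigcup (F : (set 'M[T]_(m, n))^nat) :
  (forall i, <<s mx_entry_sets >> (F i)) -> <<s mx_entry_sets >> (\bigcup_i F i).
Proof. exact: sigma_algebra_bigcup. Qed.

Definition measure_mx_display : measure_display -> measure_display.
Proof. exact. Qed.

HB.instance Definition _ := @isMeasurable.Build (measure_mx_display d)
  'M[T]_(m, n) <<s mx_entry_sets >> mx_set0 mx_setC mx_bigcup.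
End mx_measurable.

Lemma measurable_mx_entry d (T : measurableType d) m n i j :
  measurable_fun setT (fun A : 'M[T]_(m, n) => A i j).
Proof.
move=> _ B mB; rewrite setTI; apply: sub_sigma_algebra.
by exists (i, j), B.
Qed.

Lemma measurable_mxP d d' (S : measurableType d') (T : measurableType d) m n
    (f : S -> 'M[T]_(m, n)) :
  (forall i j, measurable_fun setT (fun s => f s i j)) -> measurable_fun setT f.
Proof.
move=> mf; apply: (measurability mx_entry_sets); first by [].
by move=> _ [_ [[i j] [B [mB ->]]] <-]; exact: mf.
Qed.


Section lebesgue_cV.
Context {R : realType}.

Definition cons_cV n (xv : R * 'cV[R]_n) : 'cV[R]_n.+1 :=
  col_mx (const_mx xv.1 : 'cV_1) xv.2.

Lemma measurable_cons_cV n :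
  measurable_fun setT (@cons_cV n : measurableTypeR R * 'cV[R]_n -> _).
Proof.
apply: measurable_mxP => i j.
under eq_fun do rewrite /cons_cV mxE.
case: fintype.split => k.
  by under eq_fun do rewrite mxE; exact: measurable_fst.
by apply: (measurableT_comp (measurable_mx_entry k j)); exact: measurable_snd.
Qed.

Definition uncons_cV n (v : 'cV[R]_n.+1) : R * 'cV[R]_n :=
  (v ord0 ord0, dsubmx (v : 'cV_(1 + n))).

Lemma measurable_uncons_cV n :
  measurable_fun setT (@uncons_cV n : _ -> measurableTypeR R * 'cV[R]_n).
Proof.
apply/measurable_fun_pairP; split.
  exact: measurable_mx_entry.
apply: measurable_mxP => i j; rewrite /uncons_cV /comp /=.
under eq_fun do rewrite mxE.
exact: measurable_mx_entry.
Qed.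

Lemma cons_cVK n : cancel (@cons_cV n) (@uncons_cV n).
Proof.
case=> x v; rewrite /cons_cV /uncons_cV col_mxKd; congr (_, _).
by rewrite mxE; case: fintype.splitP => // k _; rewrite mxE.
Qed.

Section step.
Variables (n : nat) (mu : {sigma_finite_measure set 'cV[R]_n -> \bar R}).

Definition lebesgue_cV_step : set 'cV[R]_n.+1 -> \bar R :=
  pushforward (lebesgue_measure \x mu)%E (@cons_cV n).

Let step0 : lebesgue_cV_step set0 = 0%E.
Proof. by apply: measure0; exact: measurable_cons_cV. Qed.

Let step_ge0 A : (0 <= lebesgue_cV_step A)%E.
Proof. by apply: measure_ge0; exact: measurable_cons_cV. Qed.

Let step_sigma_additive : semi_sigma_additive lebesgue_cV_step.
Proof.
by apply: measure_semi_sigma_additive; exact: measurable_cons_cV.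
Qed.

HB.instance Definition _ := isMeasure.Build _ _ _ lebesgue_cV_step
  step0 step_ge0 step_sigma_additive.

Let step_sigma_finite : sigma_finite setT lebesgue_cV_step.
Proof.
have /sigma_finiteP[F [TF ndF Foo]] := sigma_finiteT (@lebesgue_measure R).
have /sigma_finiteP[G [TG ndG Goo]] := sigma_finiteT mu.
exists (fun k => @uncons_cV n @^-1` (F k `*` G k)).
  rewrite -preimage_bigcup -[LHS](preimage_setT (@uncons_cV n)).
  congr (_ @^-1` _); rewrite -setXTT TF TG predeqE => -[x y]; split.
    move=> [/= [i _ Fix] [j _ Gjy]]; exists (maxn i j) => //; split.
      by move: x Fix; exact/subsetPset/ndF/leq_maxl.
    by move: y Gjy; exact/subsetPset/ndG/leq_maxr.
  by move=> [i _ []/= ? ?]; split; exists i.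
move=> k; have [mF Fk] := Foo k; have [mG Gk] := Goo k; split.
  rewrite -[X in measurable X]setTI.
  by apply: measurable_uncons_cV => //; exact: measurableX.
rewrite /lebesgue_cV_step /pushforward -comp_preimage.
rewrite (_ : uncons_cV (n:=n) \o _ = id) ?preimage_id; last first.
  by apply/funext => x /=; rewrite cons_cVK.
by rewrite product_measure1E// lte_mul_pinfty// ge0_fin_numE.
Qed.

HB.instance Definition _ := Measure_isSigmaFinite.Build _ _ _
  lebesgue_cV_step step_sigma_finite.
End step.

(* Lebesgue measure on R^n, by recursion along R^(n+1) = R x R^n. *)
Fixpoint lebesgue_cV n : {sigma_finite_measure set 'cV[R]_n -> \bar R} :=
  match n with
  | 0 => dirac (0 : 'cV[R]_0)
  | n'.+1 => lebesgue_cV_step (lebesgue_cV n')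
  end.
End lebesgue_cV.

Section linear_algebra.
Context {R : realType}.

Definition posdef n (A : 'M[R]_n) : Prop :=
  A^T = A /\ forall x : 'cV[R]_n, x != 0 -> 0 < (x^T *m A *m x) 0 0.

Definition enorm n (x : 'cV[R]_n) : R := Num.sqrt ((x^T *m x) 0 0).

(* |x|_A = |A^{-1/2} x| = sqrt (x^T A^{-1} x), for A symmetric positive
   definite. *)
Definition wnorm n (A : 'M[R]_n) (x : 'cV[R]_n) : R :=
  Num.sqrt ((x^T *m invmx A *m x) 0 0).

Definition gauss_pdf n (A : 'M[R]_n) (x : 'cV[R]_n) : R :=
  expR (- (wnorm A x ^+ 2 / 2)) / Num.sqrt ((2 * pi) ^+ n * \det A).

Definition gauss n (A : 'M[R]_n) (B : set 'cV[R]_n) : \bar R :=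
  (\int[lebesgue_cV n]_(x in B) (gauss_pdf A x)%:E)%E.

End linear_algebra.

Section probability_notions.
Context {d} {Om : measurableType d} {R : realType} (P : probability Om R).
Local Open Scope ereal_scope.

(* Independence of the sigma-algebras generated by X i, expressed for a family
   of set systems so that the X i may take values in different spaces. *)
Definition mutually_independent (I : eqType) (F : I -> set (set Om)) : Prop :=
  forall (s : seq I) (E : I -> set Om), uniq s ->
    (forall i, i \in s -> F i (E i)) ->
    P (\bigcap_(i in [set` s]) E i) = \big[mule/1]_(i <- s) P (E i).

Context {d'} {T : measurableType d'}.

(* Conditionally on the sigma-algebra F, the X n (n < N) are independent with
   common law nu, a random law that is F-measurable. *)
Definition iid_given (F : set (set Om)) (nu : Om -> set T -> \bar R)
    (N : nat) (X : 'I_N -> Om -> T) : Prop :=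
  forall (E : set Om) (B : 'I_N -> set T), F E ->
    (forall n, measurable (B n)) ->
    P (E `&` \bigcap_n (X n @^-1` B n)) =
    \int[P]_(w in E) \big[mule/1]_(n < N) nu w (B n).

Definition dist (mu nu : Om -> {measure set T -> \bar R}) : \bar R :=
  ereal_sup [set sqrte
      'E_P[fun w => (`|\int[mu w]_x f x - \int[nu w]_x f x| ^+ 2)%R] |
    f in [set f : T -> R | measurable_fun setT f /\
                           forall x, (`|f x| <= 1)%R]].

End probability_notions.

Section weighted_dirac.
Context {d} {T : measurableType d} {R : realType} (N : nat).
Variables (w : 'I_N -> {nonneg R}) (x : 'I_N -> T).
Local Open Scope ereal_scope.

Definition wdirac (A : set T) : \bar R :=
  \sum_(n < N) ((w n)%:num)%:E * \d_(x n) A.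

Let wdirac0 : wdirac set0 = 0.
Proof. by apply: big1 => n _; rewrite measure0 mule0. Qed.

Let wdirac_ge0 A : 0 <= wdirac A.
Proof. by apply: sume_ge0 => n _; exact: mule_ge0. Qed.

Let wdirac_sigma_additive : semi_sigma_additive wdirac.
Proof.
pose m (k : nat) : {measure set T -> \bar R} :=
  if insub k is Some n then mscale (w n) (dirac (x n)) else mzero.
rewrite (_ : wdirac = msum m N); first exact: measure_semi_sigma_additive.
apply/funext => A; apply: eq_bigr => n _.
by rewrite /m; case: insubP => [k _ /val_inj ->//|]; rewrite ltn_ord.
Qed.

HB.instance Definition _ := isMeasure.Build _ _ _ wdirac
  wdirac0 wdirac_ge0 wdirac_sigma_additive.
End weighted_dirac.

Record model (R : realType) (p q : nat) := Model {
  mu0 : probability 'cV[R]_p R ;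
  psi : 'cV[R]_p -> 'cV[R]_p ;
  psi_meas : measurable_fun setT psi ;
  psi_bounded : exists M, forall v, enorm (psi v) <= M ;
  obsop : 'M[R]_(q, p) ;
  sigma : R ;
  gamma : R ;
  Sigma0 : 'M[R]_p ;
  Gamma0 : 'M[R]_q ;
  sigma_gt0 : 0 < sigma ;
  gamma_gt0 : 0 < gamma ;
  Sigma0_posdef : posdef Sigma0 ;
  Gamma0_posdef : posdef Gamma0 }.

Section model_theory.
Context {R : realType} {p q : nat} (M : model R p q).
Local Notation H := (obsop M).

Definition Sigma : 'M[R]_p := sigma M ^+ 2 *: Sigma0 M.
Definition Gamma : 'M[R]_q := gamma M ^+ 2 *: Gamma0 M.
Definition Smx : 'M[R]_q := H *m Sigma *m H^T + Gamma.
Definition Cmx : 'M[R]_p := invmx (invmx Sigma + H^T *m invmx Gamma *m H).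
Definition Kgain : 'M[R]_(p, q) := Sigma *m H^T *m invmx Smx.

(* The observations (y_1, ..., y_K), one per column; y_0 plays no role. *)
Definition obs_path (K : nat) (y : nat -> 'cV[R]_q) : 'M[R]_(q, K) :=
  \matrix_(i < q, j < K) y j.+1 i 0.

Section signal.
Context {d} {Om : measurableType d} (P : probability Om R).

(* Sources of randomness: inl (inl tt) is u_0, inl (inr k) is xi_k, and inr k
   is eta_{k+1}. *)
Definition noise_events (u0 : Om -> 'cV[R]_p) (xi : nat -> Om -> 'cV[R]_p)
    (eta : nat -> Om -> 'cV[R]_q) (i : unit + nat + nat) : set (set Om) :=
  match i with
  | inl (inl _) => preimage_set_system setT u0 measurable
  | inl (inr k) => preimage_set_system setT (xi k) measurable
  | inr k => preimage_set_system setT (eta k.+1) measurable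
  end.

Record signal (u xi : nat -> {RV P >-> 'cV[R]_p})
    (y eta : nat -> {RV P >-> 'cV[R]_q}) : Prop := {
  signal_init : forall A, measurable A -> distribution P (u 0) A = mu0 M A ;
  signal_xi : forall k A, measurable A ->
    distribution P (xi k) A = gauss Sigma A ;
  signal_eta : forall k A, measurable A ->
    distribution P (eta k.+1) A = gauss Gamma A ;
  signal_indep : mutually_independent P
    (noise_events (u 0) (fun k => xi k) (fun k => eta k)) ;
  signal_step : forall k w, u k.+1 w = psi M (u k w) + xi k w ;
  signal_obs : forall k w, y k.+1 w = H *m u k.+1 w + eta k.+1 w }.

(* mu is the filtering distribution at time K: a regular conditional law of
   u_K given Y_K.  Conditional laws are only determined up to null sets of
   observations; to evaluate mu at one fixed observation we select the version
   that is weakly continuous in the observation.  The law of Y_K charges every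
   nonempty open set, so there is at most one such version. *)
Record filtering_distribution (K : nat) (u : nat -> {RV P >-> 'cV[R]_p})
    (y : nat -> {RV P >-> 'cV[R]_q})
    (mu : R.-pker 'M[R]_(q, K) ~> 'cV[R]_p) : Prop := {
  filtering_cond_law : forall A B, measurable A -> measurable B ->
    let Y w := obs_path K (fun j => y j w) in
    P (u K @^-1` A `&` Y @^-1` B) =
    (\int[P]_(w in Y @^-1` B) mu (Y w) A)%E ;
  filtering_continuous : forall f : 'cV[R]_p -> R,
    continuous f -> (exists c, forall x, `|f x| <= c) ->
    continuous (fun Y => \int[mu Y]_x f x) }.

End signal.

Section optimal_particle_filter.
Variables (N : nat) (y : nat -> 'cV[R]_q).
Implicit Type (k : nat) (v zeta : 'I_N -> 'cV[R]_p).

Definition opf_proposal k v zeta n : 'cV[R]_p :=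
  (1%:M - Kgain *m H) *m psi M (v n) + Kgain *m y k.+1 + zeta n.

Definition opf_weight_star k v n : R :=
  expR (- (wnorm Smx (y k.+1 - H *m psi M (v n)) ^+ 2 / 2)).

Lemma opf_weight_ge0 k v n :
  0 <= opf_weight_star k v n / \sum_(m < N) opf_weight_star k v m.
Proof.
by rewrite divr_ge0 ?expR_ge0// sumr_ge0// => m _; exact: expR_ge0.
Qed.

Definition opf_weight k v n : {nonneg R} := NngNum (opf_weight_ge0 k v n).

Context {d} {Om : measurableType d} (P : probability Om R).
Variables (u zeta : nat -> 'I_N -> {RV P >-> 'cV[R]_p}).

Definition opf_weighted k (w : Om) : {measure set 'cV[R]_p -> \bar R} :=
  match k with
  | 0 => mu0 M
  | k'.+1 => wdirac (opf_weight k' (fun n => u k' n w))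
      (opf_proposal k' (fun n => u k' n w) (fun n => zeta k' n w))
  end.

Definition opf_resampled k (w : Om) : {measure set 'cV[R]_p -> \bar R} :=
  wdirac (fun _ => (N%:R^-1)%:nng) (fun n => u k n w).

(* The sigma-algebra generated by u_j for j < k and zeta_j for j < l. *)
Definition opf_past k l : set (set Om) :=
  <<s [set E | (exists j n B,
                  [/\ (j < k)%N, measurable B & E = u j n @^-1` B]) \/
               (exists j n B,
                  [/\ (j < l)%N, measurable B & E = zeta j n @^-1` B])] >>.

Record optimal_particle_filter (K : nat) : Prop := {
  opf_init : iid_given P (opf_past 0 0) (fun=> mu0 M) (fun n => u 0 n) ;
  opf_noise : forall k, (k < K)%N ->
    iid_given P (opf_past k.+1 k) (fun=> gauss Cmx) (fun n => zeta k n) ;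
  opf_resample : forall k, (k < K)%N ->
    iid_given P (opf_past k.+1 k.+1) (opf_weighted k.+1)
      (fun n => u k.+1 n) }.

End optimal_particle_filter.

Definition kappa (K : nat) (y : nat -> 'cV[R]_q) : R :=
  (expR ((\big[Num.max/0]_(j < K) (wnorm Smx (y j.+1) ^+ 2)) +
         sup [set wnorm Smx (H *m psi M v) ^+ 2 | v in setT]))^-1.

End model_theory.

(* Main.v *)
Require Import Defs.
From HB Require Import structures.
From mathcomp Require Import all_boot all_order all_algebra.
From mathcomp Require Import all_classical all_reals all_analysis.
From mathcomp Require Import finmap measurable_realfun ring lra.
Set Implicit Arguments.
Unset Strict Implicit.
Unset Printing Implicit Defensive.
Import Order.TTheory GRing.Theory Num.Theory.
Import numFieldNormedType.Exports.
Local Open Scope classical_set_scope.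
Local Open Scope ring_scope.

(* Write gamma_k(f) = E[f(u_k) L_k], where L_k is the Gaussian likelihood of the
   fixed record (y_1, ..., y_k) along the signal path.  Conditioning on small
   boxes around the record, integrating out the observation noises and using the
   weak continuity of mu shows mu_K = gamma_K / gamma_K(1) on continuous
   functions, hence on all bounded measurable ones.  Completing the square in the
   product of the transition and observation densities gives
   gamma_{k+1}(f) = c gamma_k(w_k T_k f), with w_k the OPF weight and T_k the OPF
   proposal kernel.  Given the past before resampling, the pairs (resampled
   particle, proposal noise) are i.i.d., so the N-sample means of w_k T_k f and of
   w_k are within N^-1/2 + e_k of their limits in L^2, where e_k bounds the error
   of the weighted measure at step k.  As kappa <= w_k <= 1, taking the quotient
   gives e_{k+1} <= 2 kappa^-1 (e_k + N^-1/2), starting from e_0 = 0; one more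
   resampling adds N^-1/2. *)

(** The updated measure is a quotient of two sample means, and its error is split so that only the
    limit of the normalizer stands in a denominator; the empirical quotient itself survives as a
    factor, and it is a weighted average of f, hence at most 1. So one division by kappa per step is
    enough: the recursion runs with 2 kappa^-1, and the 2 kappa^-2 of the statement is reached from
    kappa <= 1. Two obstacles shape the rest. Signal and particles live on different probability
    spaces, and a filtering kernel is given at time K only; hence the recursion compares functionals
    of bounded functions instead of measures, and identities between integrals are extended from
    pi-systems by monotone classes. Moreover the Gaussian laws are bare set functions with a
    density: integrability of the densities and positivity of their normalizing constants are read
    off from the noises that have these laws. *)

Section cvg_big_real.
Context {R : realType} {T I : Type} (F : set_system T) {FF : Filter F}.
Variables (s : seq I) (f : I -> T -> R) (a : I -> R).
Hypothesis fa : forall i, f i x @[x --> F] --> a i.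

Lemma cvgr_sum : \sum_(i <- s) f i x @[x --> F] --> \sum_(i <- s) a i.
Proof. by apply: cvg_big => // x; exact: add_continuous. Qed.

Lemma cvgr_prod : \prod_(i <- s) f i x @[x --> F] --> \prod_(i <- s) a i.
Proof. by apply: cvg_big => // x; exact: mul_continuous. Qed.

End cvg_big_real.

(** * Functional monotone class arguments *)

Section bounded_functions.
Import HBNNSimple.
Context {d} {T : measurableType d} {R : realType}.
Implicit Types (f g : T -> R) (V : (T -> R) -> Prop) (L : (T -> R) -> R).

Definition bfun f := measurable_fun setT f /\ exists c, forall x, `|f x| <= c.

Lemma bfun_cst (c : R) : bfun (fun=> c).
Proof. by split; [exact: measurable_cst|exists `|c|]. Qed.

Lemma bfunD f g : bfun f -> bfun g -> bfun (fun x => f x + g x).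
Proof.
move=> [mf [c fc]] [mg [e ge]]; split; first exact: measurable_funD.
by exists (c + e) => x; rewrite (le_trans (ler_normD _ _))// lerD.
Qed.

Lemma bfunM f g : bfun f -> bfun g -> bfun (fun x => f x * g x).
Proof.
move=> [mf [c fc]] [mg [e ge]]; split; first exact: measurable_funM.
by exists (c * e) => x; rewrite normrM ler_pM.
Qed.

Lemma bfunZ (a : R) f : bfun f -> bfun (fun x => a * f x).
Proof. exact/bfunM/bfun_cst. Qed.

Lemma bfunN f : bfun f -> bfun (fun x => - f x).
Proof. by move=> /(bfunZ (-1)); under eq_fun do rewrite mulN1r. Qed.

Lemma bfunB f g : bfun f -> bfun g -> bfun (fun x => f x - g x).
Proof. by move=> bf /bfunN; exact: bfunD. Qed.

Lemma bfun_indic (A : set T) : measurable A -> bfun \1_A.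
Proof.
move=> mA; split; first exact: measurable_indic.
by exists 1 => x; rewrite indicE; case: (x \in A); rewrite ?normr1// normr0.
Qed.

Lemma bfun_sum (I : Type) (s : seq I) (F : I -> T -> R) :
  (forall i, bfun (F i)) -> bfun (fun x => \sum_(i <- s) F i x).
Proof.
move=> bF; elim: s => [|i s IH].
  by under eq_fun do rewrite big_nil; exact: bfun_cst.
by under eq_fun do rewrite big_cons; exact: bfunD.
Qed.

Lemma bfun_prod (I : Type) (s : seq I) (F : I -> T -> R) :
  (forall i, bfun (F i)) -> bfun (fun x => \prod_(i <- s) F i x).
Proof.
move=> bF; elim: s => [|i s IH].
  by under eq_fun do rewrite big_nil; exact: bfun_cst.
by under eq_fun do rewrite big_cons; exact: bfunM.
Qed.

(** Limits are bounded pointwise rather than monotone: this is the closure that dominated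
    convergence gives for an identity between integrals. *)
Record mclass V := {
  mclass_lin : forall (a : R) f g, bfun f -> bfun g -> V f -> V g ->
    V (fun x => a * f x + g x) ;
  mclass_lim : forall (h : nat -> T -> R) f c, (forall n, bfun (h n)) ->
    bfun f -> (forall n x, `|h n x| <= c) ->
    (forall x, h n x @[n --> \oo] --> f x) -> (forall n, V (h n)) -> V f }.

(** Integration against a finite signed measure, reduced to the two properties in use. As a property
    of functionals it is inherited by weighted, composed and summed integrals without building the
    corresponding measures. *)
Record daniell L := {
  daniell_lin : forall (a : R) f g, bfun f -> bfun g ->
    L (fun x => a * f x + g x) = a * L f + L g ;
  daniell_lim : forall (h : nat -> T -> R) f c, (forall n, bfun (h n)) ->
    bfun f -> (forall n x, `|h n x| <= c) ->
    (forall x, h n x @[n --> \oo] --> f x) -> L (h n) @[n --> \oo] --> L f }.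

Lemma mclass_eq L L' : daniell L -> daniell L' -> mclass (fun f => L f = L' f).
Proof.
move=> dL dL'; split.
  by move=> a f g bf bg e1 e2; rewrite !daniell_lin// e1 e2.
move=> h f c bh bf hc hf e.
have := daniell_lim dL bh bf hc hf.
under eq_fun do rewrite e.
move=> l1; have l2 := daniell_lim dL' bh bf hc hf.
exact: (cvg_unique _ l1 l2).
Qed.

Lemma functional_monotone_class V (G : set (set T)) : mclass V ->
  @measurable _ T = <<s G>> -> setI_closed G ->
  V (fun=> 1) -> (forall A, G A -> V \1_A) -> forall f, bfun f -> V f.
Proof.
move=> mV GE GI V1 VG.
have V0 : V (fun=> 0).
  have := mclass_lin mV (-1) (bfun_cst 1) (bfun_cst 1) V1 V1.
  by under eq_fun do rewrite mulr1 addNr.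
have VZ a f : bfun f -> V f -> V (fun x => a * f x).
  move=> bf Vf; have := mclass_lin mV a bf (bfun_cst 0) Vf V0.
  by under eq_fun do rewrite addr0.
have VD f g : bfun f -> bfun g -> V f -> V g -> V (fun x => f x + g x).
  move=> bf bg Vf Vg; have := mclass_lin mV 1 bf bg Vf Vg.
  by under eq_fun do rewrite mul1r.
have VA A : measurable A -> V \1_A.
  rewrite GE; apply: (dynkin_induction (P := fun A => V \1_A)) => //.
  - by rewrite indicT.
  - move=> S mS VS.
    have := mclass_lin mV (-1) (bfun_indic mS) (bfun_cst 1) VS V1.
    congr V; apply/funext => x; rewrite !indicE in_setC.
    by case: (x \in S) => /=; rewrite ?mulr1 ?addNr// mulr0 add0r.
  - move=> F mF tF VF.
    (* Indicators of the partial unions: by disjointness each one adds [\1_(F n)] to the previous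
       one, so they stay in [V], and they converge to the indicator of the whole union. *)
    pose h n := \1_(\big[setU/set0]_(i < n) F i) : T -> R.
    have mS n : measurable (\big[setU/set0]_(i < n) F i).
      exact: bigsetU_measurable.
    have hE n x : h n.+1 x = h n x + \1_(F n) x.
      rewrite /h big_ord_recr/= !indicE in_setU.
      have [xn|] := boolP (x \in F n); last by rewrite orbF addr0.
      have [|] := boolP (x \in _); last by rewrite add0r.
      move: xn => /set_mem xn /set_mem; rewrite -bigcup_mkord => -[i /= ni Fix].
      have /eqP := tF i n I I (ex_intro _ x (conj Fix xn)).
      by rewrite (ltn_eqF ni).
    apply: (mclass_lim mV (h := h) (c := 1)).
    + by move=> n; exact: bfun_indic.
    + by apply: bfun_indic; exact: bigcup_measurable.
    + by move=> n x; rewrite /h indicE; case: (x \in _); rewrite ?normr1 ?normr0.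
    + move=> x; have [[k _ Fkx]|Fx] := pselect ((\bigcup_k F k) x).
        apply: cvg_near_cst; exists k.+1 => // n /= kn.
        rewrite /h !indicE !mem_set//; first by exists k.
        by rewrite -bigcup_mkord; exists k.
      apply: cvg_near_cst; exists 0%N => // n _.
      rewrite /h !indicE !memNset// -bigcup_mkord => -[i _ Fi].
      by apply: Fx; exists i.
    + elim=> [|n IH].
        by rewrite /h big_ord0 indic0.
      rewrite (_ : h n.+1 = fun x => h n x + \1_(F n) x); last first.
        by apply/funext => x; rewrite hE.
      by apply: VD => //; exact: bfun_indic.
(* [f + c] is nonnegative and at most [2 c], hence a bounded limit of simple functions, which are
   finite combinations of indicators; the constant [c] is subtracted at the end. *)
move=> f [mf [c fc]].
have mf' : measurable_fun setT (fun x => (f x + c)%:E).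
  by apply/measurable_EFinP; apply: measurable_funD => //; exact: measurable_cst.
have f0 x : (0 <= (f x + c)%:E)%E.
  by rewrite lee_fin -lerBlDr sub0r; have := fc x; rewrite ler_norml => /andP[].
pose g := nnsfun_approx measurableT mf'.
have gle n x : g n x <= f x + c.
  by rewrite -lee_fin nnsfun_approxE; apply: (le_approx n (fun x _ => f0 x)).
have g0 n x : 0 <= g n x by exact: fun_ge0.
have gc n x : `|g n x| <= c + c.
  rewrite ger0_norm// (le_trans (gle n x))// lerD2r.
  by rewrite (le_trans (ler_norm _) (fc x)).
have bg n : bfun (g n).
  by split; [exact: measurable_funPT|exists (c + c)].
have Vg n : V (g n).
  have -> : (g n : T -> R) = fun x => \sum_(y <- fset_set (range (g n)))
      y * \1_(g n @^-1` [set y]) x.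
    apply/funext => x; rewrite fimfunE fsbig_finite//.
  elim: (fset_set (range (g n)) : seq R) => [|y s IH].
    by under eq_fun do rewrite big_nil.
  under eq_fun do rewrite big_cons.
  apply: VD => //; last by apply: VZ; [exact: bfun_indic|exact: VA].
    by apply/bfunZ/bfun_indic.
  by apply: bfun_sum => i; exact/bfunZ/bfun_indic.
have bfc : bfun (fun x => f x + c).
  by apply: bfunD; [split => //; exists c|exact: bfun_cst].
have Vfc : V (fun x => f x + c).
  apply: (mclass_lim mV (h := g) (c := c + c)) => //.
  move=> x.
  by have /(_ I)/fine_cvgP[_] := cvg_nnsfun_approx measurableT mf' (fun x _ => f0 x) (x := x).
have := mclass_lin mV (- c) (bfun_cst 1) bfc V1 Vfc.
congr V; apply/funext => x; by rewrite mulr1 addrC addrK.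
Qed.

Lemma mclass_pi (V : (T -> R) -> Prop) (G : set (set T)) : mclass V ->
  @measurable _ T = <<s G>> -> setI_closed G -> G setT ->
  (forall A, G A -> V \1_A) -> forall f, bfun f -> V f.
Proof.
move=> mV GE GI GT VG; apply: (functional_monotone_class mV GE GI) => //.
by have := VG _ GT; rewrite indicT.
Qed.

End bounded_functions.

Lemma bfun_comp d d' (S : measurableType d) (T : measurableType d')
    (R : realType) (f : T -> R) (X : S -> T) :
  measurable_fun setT X -> bfun f -> bfun (f \o X).
Proof. by move=> mX [mf [c fc]]; split; [exact: measurableT_comp|exists c => x; exact: fc]. Qed.

Section mclass_generators.
Context {d d'} {T : measurableType d} {S : measurableType d'} {R : realType}.

Lemma mclass_measurable (V : (T -> R) -> Prop) : mclass V ->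
  (forall A, measurable A -> V \1_A) -> forall f, bfun f -> V f.
Proof.
move=> mV VA f bf; apply: (mclass_pi mV (G := measurable)) => //.
- by rewrite sigma_algebra_id//; exact: sigma_algebra_measurable.
- exact: measurableI.
Qed.

Lemma mclass_prod (V : (T * S -> R) -> Prop) : mclass V ->
  (forall A B, measurable A -> measurable B ->
    V (fun x => \1_A x.1 * \1_B x.2)) -> forall f, bfun f -> V f.
Proof.
move=> mV VAB f bf.
have VX A B : measurable A -> measurable B -> V \1_(A `*` B).
  move=> mA mB; have := VAB _ _ mA mB.
  congr V; apply/funext => -[x y] /=; rewrite !indicE in_setX/=.
  by case: (x \in A) => /=; rewrite (mul1r, mul0r).
apply: (mclass_pi mV (G := [set A `*` B | A in measurable & B in measurable])) => //.
- exact: measurable_prod_measurableType.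
- move=> _ _ [A mA [B mB <-]] [A' mA' [B' mB' <-]].
  exists (A `&` A'); first exact: measurableI.
  exists (B `&` B'); first exact: measurableI.
  by rewrite setXI.
- by exists setT => //; exists setT => //; rewrite setXTT.
- by move=> _ [A mA [B mB <-]]; exact: VX.
Qed.

End mclass_generators.

(** * Integrals of bounded functions against finite measures *)

Lemma probability_ltoo d (T : measurableType d) (R : realType)
  (P : probability T R) : (P setT < +oo)%E.
Proof. by rewrite probability_setT ltry. Qed.

Section finite_integral.
Context {d} {T : measurableType d} {R : realType}.
Variable m : {measure set T -> \bar R}.
Hypothesis moo : (m setT < +oo)%E.

Lemma bfun_integrable (f : T -> R) : bfun f -> m.-integrable setT (EFin \o f).
Proof.
move=> [mf [c fc]]; apply: measurable_bounded_integrable => //.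
exists c; split; first exact: num_real.
by move=> y cy x _; exact: le_trans (fc x) (ltW cy).
Qed.

Lemma bfun_RintegralE (f : T -> R) : bfun f ->
  (\int[m]_x (f x)%:E)%E = (\int[m]_x f x)%:E.
Proof.
move=> bf; rewrite /Rintegral fineK//.
by apply: integrable_fin_num => //; exact: bfun_integrable.
Qed.

Lemma Rintegral_indic (A : set T) : measurable A ->
  \int[m]_x \1_A x = fine (m A).
Proof. by move=> mA; rewrite /Rintegral integral_indic// setIT. Qed.

Lemma daniell_Rintegral : daniell (fun f : T -> R => \int[m]_x f x).
Proof.
split.
  move=> a f g bf bg; rewrite RintegralD ?RintegralZl//.
  - exact: bfun_integrable.
  - by apply: bfun_integrable; exact: bfunZ.
  - exact: bfun_integrable.
move=> h f c bh bf hc hf.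
have [] := @dominated_convergence _ _ _ m setT measurableT
  (fun n => EFin \o h n) (EFin \o f) (cst c%:E).
- by move=> n; apply/measurable_EFinP; case: (bh n).
- by apply/measurable_EFinP; case: bf.
- by apply: aeW => x _ /=; apply: cvg_EFin; [exact: nearW|exact: hf].
- exact: (bfun_integrable (bfun_cst c)).
- by apply: aeW => x n _ /=; rewrite lee_fin.
- by move=> _ _; under eq_fun do rewrite bfun_RintegralE//; rewrite bfun_RintegralE// => /fine_cvgP[].
Qed.

Lemma daniell_norm_le (f : T -> R) c : bfun f -> (forall x, `|f x| <= c) ->
  `|\int[m]_x f x| <= c * fine (m setT).
Proof.
move=> bf fc; rewrite (le_trans (le_normr_Rintegral _ _))//.
  exact: bfun_integrable.
rewrite -Rintegral_cst// le_Rintegral//; last exact: (bfun_integrable (bfun_cst c)).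
apply: bfun_integrable; case: bf => mf [e fe]; split.
  exact: measurableT_comp.
by exists e => x; rewrite normr_id.
Qed.

Lemma bfun_le_Rintegral (f g : T -> R) : bfun f -> bfun g ->
  (forall x, f x <= g x) -> \int[m]_x f x <= \int[m]_x g x.
Proof. by move=> bf bg fg; apply: le_Rintegral => //; exact: bfun_integrable. Qed.

Lemma bfun_RintegralD (f g : T -> R) : bfun f -> bfun g ->
  \int[m]_x (f x + g x) = \int[m]_x f x + \int[m]_x g x.
Proof. by move=> bf bg; apply: RintegralD => //; exact: bfun_integrable. Qed.

Lemma bfun_RintegralZ (a : R) (f : T -> R) : bfun f ->
  \int[m]_x (a * f x) = a * \int[m]_x f x.
Proof. by move=> bf; apply: RintegralZl => //; exact: bfun_integrable. Qed.

Lemma bfun_Rintegral_sum (I : Type) (s : seq I) (F : I -> T -> R) :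
  (forall i, bfun (F i)) ->
  \int[m]_x (\sum_(i <- s) F i x) = \sum_(i <- s) \int[m]_x F i x.
Proof.
move=> bF; elim: s => [|i s IH].
  by under eq_Rintegral do rewrite big_nil; rewrite Rintegral_cst// mul0r big_nil.
under eq_Rintegral do rewrite big_cons.
by rewrite big_cons -IH bfun_RintegralD//; exact: bfun_sum.
Qed.

End finite_integral.

(** * Functionals and operators that act like integrals and probability kernels *)

Section markov_operators.
Context {R : realType}.

Section constructions.
Context {d d'} {S : measurableType d} {T : measurableType d'}.

Lemma daniell_pull (L : (S -> R) -> R) (X : S -> T) : daniell L ->
  measurable_fun setT X -> daniell (fun f => L (fun s => f (X s))).
Proof.
move=> dL mX; split.
  by move=> a f g bf bg; rewrite (daniell_lin dL)//; exact: bfun_comp.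
move=> h f c bh bf hc hf; apply: (daniell_lim dL (c := c)) => //.
  by move=> n; exact: bfun_comp.
exact: bfun_comp.
Qed.

Lemma daniell_mul (L : (T -> R) -> R) (W : T -> R) : daniell L -> bfun W ->
  daniell (fun f => L (fun s => f s * W s)).
Proof.
move=> dL bW; split.
  move=> a f g bf bg.
  under [X in L X]eq_fun do rewrite mulrDl -mulrA.
  by rewrite (daniell_lin dL)//; exact: bfunM.
move=> h f c bh bf hc hf; have [_ [e We]] := bW.
apply: (daniell_lim dL (c := c * e)) => //.
- by move=> n; exact: bfunM.
- exact: bfunM.
- by move=> n x; rewrite normrM ler_pM.
- by move=> x; apply: cvgMr_tmp.
Qed.

Lemma daniellZ (L : (T -> R) -> R) (a : R) : daniell L ->
  daniell (fun f => a * L f).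
Proof.
move=> dL; split.
  by move=> b f g bf bg; rewrite (daniell_lin dL)// mulrDr mulrCA.
by move=> h f c bh bf hc hf; apply: cvgMl_tmp; exact: (daniell_lim dL bh bf hc hf).
Qed.

Lemma daniell0 : daniell (fun _ : T -> R => 0 : R).
Proof.
split; first by move=> *; rewrite mulr0 addr0.
by move=> *; exact: cvg_cst.
Qed.

Lemma daniellD (L L' : (T -> R) -> R) : daniell L -> daniell L' ->
  daniell (fun f => L f + L' f).
Proof.
move=> dL dL'; split.
  move=> b f g bf bg; rewrite (daniell_lin dL)// (daniell_lin dL')//.
  by rewrite mulrDr addrACA.
move=> h f c bh bf hc hf; apply: cvgD.
  exact: (daniell_lim dL bh bf hc hf).
exact: (daniell_lim dL' bh bf hc hf).
Qed.

Lemma daniell_sum (I : Type) (s : seq I) (L : I -> (T -> R) -> R) :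
  (forall i, daniell (L i)) -> daniell (fun f => \sum_(i <- s) L i f).
Proof.
move=> dL; elim: s => [|i s IH].
  by under eq_fun do rewrite big_nil; exact: daniell0.
by under eq_fun do rewrite big_cons; exact: daniellD.
Qed.

Lemma daniell_eval (x : T) : daniell (fun f : T -> R => f x).
Proof. by split => // h f c bh bf hc hf; exact: hf. Qed.

(** What is used of the action of a probability kernel from [S] to [T] on functions. In this form
    composing kernels is composing functions, and a random measure is treated as a kernel from the
    sample space. *)
Record markov_op (A : (T -> R) -> S -> R) := {
  markov_bfun : forall f, bfun f -> bfun (A f) ;
  markov_bound : forall f c, bfun f -> (forall x, `|f x| <= c) ->
    forall s, `|A f s| <= c ;
  markov_daniell : forall s, daniell (fun f => A f s) }.

Lemma daniell_markov (L : (S -> R) -> R) (A : (T -> R) -> S -> R) :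
  daniell L -> markov_op A -> daniell (fun f => L (A f)).
Proof.
move=> dL mA; split.
  move=> a f g bf bg; rewrite -(daniell_lin dL).
  - by congr L; apply/funext => s; rewrite (daniell_lin (markov_daniell mA s)).
  - exact: (markov_bfun mA).
  - exact: (markov_bfun mA).
move=> h f c bh bf hc hf; apply: (daniell_lim dL (c := c)).
- by move=> n; exact: (markov_bfun mA).
- exact: (markov_bfun mA).
- by move=> n; exact: (markov_bound mA).
- by move=> s; exact: (daniell_lim (markov_daniell mA s) bh bf hc hf).
Qed.

(** Reduces the measurability of [s |-> A f s] to indicators of a generating pi-system. *)
Lemma measurable_daniell (A : (T -> R) -> S -> R) :
  (forall s, daniell (fun f => A f s)) ->
  mclass (fun f => measurable_fun setT (A f)).
Proof.
move=> dA; split.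
  move=> a f g bf bg mf mg.
  rewrite (_ : A _ = fun s => a * A f s + A g s); last first.
    by apply/funext => s; rewrite (daniell_lin (dA s)).
  by apply: measurable_funD => //; apply: measurable_funM => //; exact: measurable_cst.
move=> h f c bh bf hc hf mh; apply: (measurable_fun_cvg mh) => s _.
exact: (daniell_lim (dA s) bh bf hc hf).
Qed.

Lemma markov_kernel (l : S -> {measure set T -> \bar R}) :
  (forall U, measurable U -> measurable_fun setT (l ^~ U)) ->
  (forall s, l s setT = 1%E) -> markov_op (fun f s => \int[l s]_x f x).
Proof.
move=> ml l1.
have loo s : (l s setT < +oo)%E by rewrite l1 ltry.
have dl s := daniell_Rintegral (loo s).
have bl f c s : bfun f -> (forall x, `|f x| <= c) -> `|\int[l s]_x f x| <= c.
  by move=> bf fc; have := daniell_norm_le (loo s) bf fc; rewrite l1 mulr1.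
split => //; last by move=> f c bf fc s; exact: bl.
move=> f bf; split; last by have [_ [c fc]] := bf; exists c => s; exact: bl.
move: f bf; apply: (mclass_measurable (measurable_daniell dl)) => U mU.
under eq_fun do rewrite Rintegral_indic//.
by apply: measurableT_comp => //; exact: ml.
Qed.

End constructions.

End markov_operators.

(** * Monte Carlo error of conditionally i.i.d. samples *)

Section L2.
Context {d} {T : measurableType d} {R : realType} (P : probability T R).
Implicit Types f g : T -> R.

Let Poo : (P setT < +oo)%E. Proof. exact: probability_ltoo. Qed.

(** The integral of [(s f + t g)^2] is a nonnegative quadratic form in [(s, t)]; suitable values of
    [s] and [t] give its discriminant. *)
Lemma bfun_cauchy_schwarz f g : bfun f -> bfun g ->
  (\int[P]_x (f x * g x)) ^+ 2 <=
  (\int[P]_x (f x ^+ 2)) * (\int[P]_x (g x ^+ 2)).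
Proof.
move=> bf bg.
have bff : bfun (fun x => f x ^+ 2) by exact: bfunM.
have bgg : bfun (fun x => g x ^+ 2) by exact: bfunM.
have bfg : bfun (fun x => f x * g x) by exact: bfunM.
set p := \int[P]_x (f x ^+ 2); set q := \int[P]_x (g x ^+ 2).
set r := \int[P]_x (f x * g x).
have p0 : 0 <= p by apply: Rintegral_ge0 => x _; exact: sqr_ge0.
have q0 : 0 <= q by apply: Rintegral_ge0 => x _; exact: sqr_ge0.
have H s t : 0 <= s ^+ 2 * p + ((2 * s * t) * r + t ^+ 2 * q).
  rewrite /p /q /r -!(bfun_RintegralZ Poo)//.
  rewrite -!(bfun_RintegralD Poo)//; try do ?[done | exact: bfunZ | apply: bfunD].
  apply: Rintegral_ge0 => x _.
  suff -> : s ^+ 2 * f x ^+ 2 + (2 * s * t * (f x * g x) + t ^+ 2 * g x ^+ 2) =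
    (s * f x + t * g x) ^+ 2 by exact: sqr_ge0.
  ring.
have [p_eq0|pn0] := eqVneq p 0.
  rewrite p_eq0 mul0r.
  have [->|rn0] := eqVneq r 0; first by rewrite expr0n.
  (* With [p = 0] and [t = 1] the form is [2 s r + q]; this [s] makes it equal to -1. *)
  have := H (- (q + 1) / (2 * r)) 1; rewrite p_eq0 expr1n mul1r.
  have -> : 2 * (- (q + 1) / (2 * r)) * 1 * r = - (q + 1) by field.
  by move=> h; exfalso; lra.
have pp : 0 < p by rewrite lt0r pn0.
(* The minimizer [s = - t r / p], with [t = p] to clear the division. *)
have := H (- r) p.
have -> : (- r) ^+ 2 * p + (2 * - r * p * r + p ^+ 2 * q) = p * (p * q - r ^+ 2) by ring.
by rewrite pmulr_rge0// subr_ge0.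
Qed.

Lemma bfun_minkowski f g (a b : R) : bfun f -> bfun g -> 0 <= a -> 0 <= b ->
  \int[P]_x (f x ^+ 2) <= a ^+ 2 -> \int[P]_x (g x ^+ 2) <= b ^+ 2 ->
  \int[P]_x ((f x + g x) ^+ 2) <= (a + b) ^+ 2.
Proof.
move=> bf bg a0 b0 fa gb.
have bff : bfun (fun x => f x ^+ 2) by exact: bfunM.
have bgg : bfun (fun x => g x ^+ 2) by exact: bfunM.
have bfg : bfun (fun x => f x * g x) by exact: bfunM.
have -> : \int[P]_x ((f x + g x) ^+ 2) = \int[P]_x (f x ^+ 2) +
    (2 * \int[P]_x (f x * g x) + \int[P]_x (g x ^+ 2)).
  rewrite -(bfun_RintegralZ Poo)// -!(bfun_RintegralD Poo)//;
    try do ?[done | exact: bfunZ | apply: bfunD].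
  by apply: eq_Rintegral => x _; ring.
have fg : \int[P]_x (f x * g x) <= a * b.
  have [|fg0] := leP (\int[P]_x (f x * g x)) 0.
    by move=> /le_trans; apply; exact: mulr_ge0.
  rewrite -(@ler_pXn2r _ 2)// ?nnegrE ?mulr_ge0//; last exact: ltW.
  rewrite (le_trans (bfun_cauchy_schwarz bf bg))// exprMn ler_pM//.
  - by apply: Rintegral_ge0 => x _; exact: sqr_ge0.
  - by apply: Rintegral_ge0 => x _; exact: sqr_ge0.
rewrite [leRHS](_ : _ = a ^+ 2 + (2 * (a * b) + b ^+ 2)); last by ring.
by rewrite lerD// lerD// ler_pM2l.
Qed.

End L2.

Section monte_carlo.
Context {d d'} {Om : measurableType d} {T : measurableType d'} {R : realType}.
Variables (P : probability Om R) (F : set (set Om)).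
Hypothesis Fm : F `<=` measurable.
Variables (N : nat) (Z : 'I_N -> Om -> T).
Hypothesis mZ : forall n, measurable_fun setT (Z n).
Variable A : (T -> R) -> g_sigma_algebraType F -> R.
Hypothesis mA : markov_op A.
Variable G : set (set T).
Hypotheses (GE : @measurable _ T = <<s G>>) (GI : setI_closed G) (GT : G setT).
Hypothesis AZ1 : forall n E B, <<s F>> E -> G B ->
  \int[P]_w (\1_E w * \1_B (Z n w)) = \int[P]_w (\1_E w * A \1_B w).
Hypothesis AZ2 : forall n m B B', n != m -> G B -> G B' ->
  \int[P]_w (\1_B (Z n w) * \1_B' (Z m w)) = \int[P]_w (A \1_B w * A \1_B' w).

Let Poo : (P setT < +oo)%E. Proof. exact: probability_ltoo. Qed.

Lemma sub_g_sigma_algebra E : <<s F>> E -> measurable E.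
Proof.
move=> FE.
by move: E FE; apply: smallest_sub => //; exact: sigma_algebra_measurable.
Qed.

Lemma measurable_id_g_sigma_algebra :
  measurable_fun setT (id : Om -> g_sigma_algebraType F).
Proof. by move=> _ E FE; rewrite setTI; exact: sub_g_sigma_algebra. Qed.

Let bfunF (h : g_sigma_algebraType F -> R) : bfun h -> bfun (h : Om -> R).
Proof. exact: (bfun_comp measurable_id_g_sigma_algebra). Qed.

Let dF : daniell (fun h : g_sigma_algebraType F -> R => \int[P]_w h w).
Proof. exact: (daniell_pull (daniell_Rintegral Poo) measurable_id_g_sigma_algebra). Qed.

Let bZ n (phi : T -> R) : bfun phi -> bfun (fun w => phi (Z n w)).
Proof. exact: bfun_comp. Qed.

(** [A phi] is the conditional expectation of [phi (Z n)] given [F]: two monotone class arguments,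
    in [h] and then in [phi], lead back to [AZ1]. *)
Lemma cond_iid1 n phi (h : g_sigma_algebraType F -> R) : bfun phi -> bfun h ->
  \int[P]_w (h w * phi (Z n w)) = \int[P]_w (h w * A phi w).
Proof.
move=> bphi; move: h; apply: mclass_measurable.
  apply: mclass_eq.
    exact: (daniell_pull (daniell_mul (daniell_Rintegral Poo) (bZ n bphi))
      measurable_id_g_sigma_algebra).
  exact: (daniell_mul dF (markov_bfun mA bphi)).
move=> E FE; have bE := bfunF (bfun_indic FE).
move: phi bphi; apply: (mclass_pi _ GE GI GT).
- rewrite (_ : (fun _ => _) = fun phi =>
      \int[P]_w (phi (Z n w) * \1_E w) = \int[P]_w (A phi w * \1_E w)).
    apply: mclass_eq.
      exact: (daniell_pull (daniell_mul (daniell_Rintegral Poo) bE)).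
    exact: (daniell_markov (daniell_mul dF (bfun_indic FE)) mA).
  apply/funext => phi; congr (_ = _);
    by apply: eq_Rintegral => w _; rewrite mulrC.
- by move=> B GB; exact: AZ1.
Qed.

(** No [F]-measurable factor is carried along, since a variance only involves the unconditional
    correlations of two samples. *)
Lemma cond_iid2 n m phi phi' : n != m -> bfun phi -> bfun phi' ->
  \int[P]_w (phi (Z n w) * phi' (Z m w)) = \int[P]_w (A phi w * A phi' w).
Proof.
move=> nm bphi bphi'; move: phi bphi; apply: (mclass_pi _ GE GI GT).
- apply: mclass_eq.
    exact: (daniell_pull (daniell_mul (daniell_Rintegral Poo) (bZ m bphi'))).
  exact: (daniell_markov (daniell_mul dF (markov_bfun mA bphi')) mA).
move=> B GB; move: phi' bphi'; apply: (mclass_pi _ GE GI GT).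
- rewrite (_ : (fun _ => _) = fun phi =>
      \int[P]_w (phi (Z m w) * \1_B (Z n w)) = \int[P]_w (A phi w * A \1_B w)).
    have mB : measurable B by rewrite GE; exact: sub_sigma_algebra.
    apply: mclass_eq.
      exact: (daniell_pull (daniell_mul (daniell_Rintegral Poo) (bZ n (bfun_indic mB)))).
    exact: (daniell_markov (daniell_mul dF (markov_bfun mA (bfun_indic mB))) mA).
  apply/funext => phi; congr (_ = _);
    by apply: eq_Rintegral => w _; rewrite mulrC.
- by move=> B' GB'; exact: AZ2.
Qed.

(** The deviations [phi (Z n) - A phi] are orthogonal in L^2 with norms at most 1, so the square of
    their sum has expectation at most [N], to be divided by [N^2]. *)
Lemma monte_carlo phi : (0 < N)%N -> bfun phi -> (forall x, `|phi x| <= 1) ->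
  \int[P]_w ((N%:R^-1 * \sum_(n < N) phi (Z n w) - A phi w) ^+ 2) <= N%:R^-1.
Proof.
move=> N0 bphi phi1.
have bA : @bfun _ Om R (A phi) := bfunF (markov_bfun mA bphi).
pose D n (w : Om) := phi (Z n w) - A phi w.
have bD n : bfun (D n) by exact/bfunB/bA/bZ.
have NR0 : N%:R != 0 :> R by rewrite pnatr_eq0 -lt0n.
have -> : \int[P]_w ((N%:R^-1 * \sum_(n < N) phi (Z n w) - A phi w) ^+ 2) =
    \int[P]_w (N%:R^-1 ^+ 2 * \sum_(n < N) \sum_(m < N) (D n w * D m w)).
  apply: eq_Rintegral => w _.
  have -> : \sum_(n < N) \sum_(m < N) (D n w * D m w) = (\sum_(n < N) D n w) ^+ 2.
    by rewrite expr2 big_distrlr.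
  rewrite -exprMn sumrB sumr_const card_ord mulrBr; congr (_ ^+ 2); congr (_ - _).
  by rewrite -[A phi w *+ N]mulr_natl mulKf.
rewrite (bfun_RintegralZ Poo); last first.
  by apply: bfun_sum => n; apply: bfun_sum => m; exact: bfunM.
rewrite (bfun_Rintegral_sum Poo); last first.
  by move=> n; apply: bfun_sum => m; exact: bfunM.
(* By [cond_iid1] with [h = A phi], both mixed terms equal the integral of [(A phi)^2], of which one
   negative copy remains. *)
have DE n m : \int[P]_w (D n w * D m w) =
    \int[P]_w (phi (Z n w) * phi (Z m w)) - \int[P]_w (A phi w * A phi w).
  have -> : \int[P]_w (D n w * D m w) =
      \int[P]_w (phi (Z n w) * phi (Z m w) +
        (-1 * (A phi w * phi (Z n w)) + (-1 * (A phi w * phi (Z m w)) +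
         A phi w * A phi w))).
    by apply: eq_Rintegral => w _; rewrite /D; ring.
  have b1 k : bfun (fun w : Om => A phi w * phi (Z k w)) by exact/bfunM/bZ.
  have b2 k l : bfun (fun w => phi (Z k w) * phi (Z l w)) by apply: bfunM; exact: bZ.
  have b3 : bfun (fun w : Om => A phi w * A phi w) by exact: bfunM.
  rewrite !(bfun_RintegralD Poo) ?(bfun_RintegralZ Poo)//;
    try do ?[done | exact: bfunZ | apply: bfunD | exact: bfunM].
  rewrite (cond_iid1 n bphi (markov_bfun mA bphi)).
  rewrite (cond_iid1 m bphi (markov_bfun mA bphi)); ring.
have DD n m : \int[P]_w (D n w * D m w) <= (n == m)%:R.
  rewrite DE; have [<-|nm] := eqVneq n m; last first.
    by rewrite cond_iid2// subrr.
  rewrite lerBlDr (le_trans (y := 1))//.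
    rewrite -[leRHS](_ : \int[P]_w 1 = 1); last first.
      by rewrite Rintegral_cst// mul1r; exact: (congr1 fine (probability_setT P)).
    apply: (bfun_le_Rintegral Poo); [by apply: bfunM; exact: bZ|exact: bfun_cst|].
    move=> w; rewrite (le_trans (ler_norm _))// normrM mulr_ile1//; exact: phi1.
  rewrite lerDl; apply: Rintegral_ge0 => w _; rewrite -expr2; exact: sqr_ge0.
rewrite (le_trans (y := N%:R^-1 ^+ 2 * \sum_(n < N) 1))//.
  rewrite ler_pM2l ?exprn_gt0 ?invr_gt0 ?ltr0n// ler_sum// => n _.
  rewrite (bfun_Rintegral_sum Poo); last by move=> m; exact: bfunM.
  rewrite (le_trans (ler_sum _ (fun m _ => DD n m)))//.
  by rewrite (bigD1 n)//= eqxx big1 ?addr0// => m; rewrite eq_sym => /negbTE ->.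
by rewrite sumr_const card_ord expr2 -mulrA mulVf// mulr1.
Qed.

End monte_carlo.

(** * Gaussian densities *)

Section quadratic_forms.
Context {R : realType}.

Definition qform n (A : 'M[R]_n) (x : 'cV[R]_n) : R := (x^T *m A *m x) 0 0.

Lemma qformE n (A : 'M[R]_n) x :
  qform A x = \sum_i \sum_j A i j * (x i 0 * x j 0).
Proof.
rewrite /qform mxE exchange_big/=; apply: eq_bigr => j _.
rewrite mxE big_distrl/=; apply: eq_bigr => i _.
by rewrite mxE mulrAC mulrC mulrA.
Qed.

Lemma posdef_ge0 n (A : 'M[R]_n) x : posdef A -> 0 <= qform A x.
Proof.
move=> [_ Ap]; have [->|x0] := eqVneq x 0; last exact/ltW/Ap.
by rewrite /qform mulmx0 mxE.
Qed.

(** A nonzero row of the kernel would be a nonzero vector on which the form vanishes. *)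
Lemma posdef_unitmx n (A : 'M[R]_n) : posdef A -> A \in unitmx.
Proof.
move=> [At Ap]; rewrite -row_free_unit -kermx_eq0; apply/eqP/row_matrixP => i.
rewrite row0; apply/eqP/negPn/negP => ri0.
have : (row i (kermx A))^T != 0 by rewrite -trmx0 (inj_eq trmx_inj).
move=> /Ap; rewrite trmxK -row_mul mulmx_ker row0 mul0mx mxE ltxx//.
Qed.

Lemma posdef_inv n (A : 'M[R]_n) : posdef A -> posdef (invmx A).
Proof.
move=> pA; have uA := posdef_unitmx pA; have [At Ap] := pA; split.
  by rewrite trmx_inv At.
move=> x x0; have : invmx A *m x != 0.
  by apply: contra_neq x0 => e; rewrite -(mulKVmx uA x) e mulmx0.
by move=> /Ap; rewrite trmx_mul trmx_inv At mulmxKV// mulmxA.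
Qed.

Lemma posdefD_congr m n (A : 'M[R]_m) (B : 'M[R]_n) (F : 'M[R]_(m, n)) :
  posdef A -> posdef B -> posdef (A + F *m B *m F^T).
Proof.
move=> [At Ap] pB; have [Bt Bp] := pB; split.
  by rewrite linearD/= !trmx_mul trmxK At Bt mulmxA.
move=> x x0; rewrite mulmxDr mulmxDl mxE ltr_pwDl//; first exact: Ap.
have := posdef_ge0 (F^T *m x) pB.
by rewrite /qform trmx_mul trmxK !mulmxA.
Qed.

Lemma posdefZ n (A : 'M[R]_n) (a : R) : 0 < a -> posdef A -> posdef (a *: A).
Proof.
move=> a0 [At Ap]; split; first by rewrite linearZ/= At.
by move=> x x0; rewrite -scalemxAr -scalemxAl mxE mulr_gt0// Ap.
Qed.

Lemma wnorm_sqr n (A : 'M[R]_n) x : posdef A ->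
  wnorm A x ^+ 2 = qform (invmx A) x.
Proof. by move=> /posdef_inv/posdef_ge0 A0; rewrite /wnorm sqr_sqrtr//; exact: A0. Qed.

Definition bform n (A : 'M[R]_n) (x y : 'cV[R]_n) : R := (x^T *m A *m y) 0 0.

Lemma bformDr n (A : 'M[R]_n) x y z : bform A x (y + z) = bform A x y + bform A x z.
Proof. by rewrite /bform mulmxDr mxE. Qed.

Lemma bformDl n (A : 'M[R]_n) x y z : bform A (x + y) z = bform A x z + bform A y z.
Proof. by rewrite /bform [(x + y)^T]linearD/= !mulmxDl mxE. Qed.

Lemma bformNr n (A : 'M[R]_n) x y : bform A x (- y) = - bform A x y.
Proof. by rewrite /bform mulmxN mxE. Qed.

Lemma bformNl n (A : 'M[R]_n) x y : bform A (- x) y = - bform A x y.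
Proof. by rewrite /bform [(- x)^T]linearN/= !mulNmx mxE. Qed.

Lemma bformC n (A : 'M[R]_n) x y : A^T = A -> bform A x y = bform A y x.
Proof.
move=> At; rewrite /bform -[in LHS](trmxK (x^T *m A *m y)) mxE.
by rewrite !trmx_mul trmxK At mulmxA.
Qed.

Lemma qform_parallelogram n (A : 'M[R]_n) x y :
  qform A (x + y) + qform A (x - y) = 2 * qform A x + 2 * qform A y.
Proof.
rewrite -![qform _ _]/(bform _ _ _) !(bformDl, bformDr, bformNl, bformNr).
ring.
Qed.

Lemma qform_bounded n (A : 'M[R]_n) (c : R) :
  exists e, forall x, enorm x <= c -> qform A x <= e.
Proof.
exists (\sum_i \sum_j `|A i j| * (c * c)) => x xc; rewrite qformE.
have xi i : `|x i 0| <= c.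
  apply: le_trans xc; rewrite /enorm -sqrtr_sqr ler_wsqrtr//.
  rewrite mxE (bigD1 i)//= mxE -expr2 lerDl; apply: sumr_ge0 => j _.
  by rewrite mxE -expr2 sqr_ge0.
apply: ler_sum => i _; apply: ler_sum => j _.
rewrite (le_trans (ler_norm _))// normrM ler_wpM2l// normrM ler_pM//; exact: xi.
Qed.

End quadratic_forms.

(** * The Kalman gain and completion of the square *)

Section model_matrices.
Context {R : realType} {p q : nat} (M : model R p q).
Local Notation H := (obsop M).
Local Notation Sig := (Sigma M).
Local Notation Gam := (Gamma M).
Local Notation S := (Smx M).
Local Notation C := (Cmx M).
Local Notation Kg := (Kgain M).

Lemma posdef_Sigma : posdef Sig.
Proof. by apply: posdefZ; [rewrite exprn_gt0// sigma_gt0|exact: Sigma0_posdef]. Qed.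

Lemma posdef_Gamma : posdef Gam.
Proof. by apply: posdefZ; [rewrite exprn_gt0// gamma_gt0|exact: Gamma0_posdef]. Qed.

Lemma posdef_Smx : posdef S.
Proof. by rewrite /Smx addrC; exact: (posdefD_congr H posdef_Gamma posdef_Sigma). Qed.

Lemma posdef_Cinv : posdef (invmx Sig + H^T *m invmx Gam *m H).
Proof.
have := posdefD_congr H^T (posdef_inv posdef_Sigma) (posdef_inv posdef_Gamma).
by rewrite trmxK.
Qed.

Lemma posdef_Cmx : posdef C. Proof. exact/posdef_inv/posdef_Cinv. Qed.

Lemma invmx_Cmx : invmx C = invmx Sig + H^T *m invmx Gam *m H.
Proof. exact: invmxK. Qed.

(** [(Sig^-1 + H^T Gam^-1 H) Sig H^T = H^T Gam^-1 (Gam + H Sig H^T) = H^T Gam^-1 S], and the factor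
    [S] cancels the [S^-1] of the gain. *)
Lemma Cinv_Kgain : invmx C *m Kg = H^T *m invmx Gam.
Proof.
have uS := posdef_unitmx posdef_Sigma; have uG := posdef_unitmx posdef_Gamma.
have uSm := posdef_unitmx posdef_Smx.
rewrite invmx_Cmx /Kgain mulmxDl !mulmxA mulVmx// mul1mx -mulmxDl.
rewrite -[X in (X + _) *m _](mulmxKV uG) -!mulmxA -!mulmxDr.
rewrite (_ : Gam + H *m (Sig *m H^T) = S); last by rewrite addrC mulmxA.
by rewrite mulmxA mulmxK.
Qed.

(** By [Cinv_Kgain] the left side is [S^-1 (H Sig H^T) Gam^-1], where [H Sig H^T = S - Gam]. *)
Lemma Kgain_Cinv_Kgain : Kg^T *m invmx C *m Kg = invmx Gam - invmx S.
Proof.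
have uS := posdef_unitmx posdef_Sigma; have uG := posdef_unitmx posdef_Gamma.
have uSm := posdef_unitmx posdef_Smx.
rewrite -mulmxA Cinv_Kgain /Kgain !trmx_mul trmxK trmx_inv.
have [-> _] := posdef_Smx; have [-> _] := posdef_Sigma.
have -> : invmx S *m (H *m Sig) *m (H^T *m invmx Gam) =
    invmx S *m (S - Gam) *m invmx Gam.
  by rewrite {2}/Smx addrK !mulmxA.
by rewrite mulmxBr mulVmx// mulmxBl mul1mx mulmxK.
Qed.

(** Prior times likelihood against evidence times posterior, at the level of exponents. The terms in
    [x] agree by definition of [C], the mixed ones by [Cinv_Kgain], those in [r] by
    [Kgain_Cinv_Kgain]. *)
Lemma qform_complete_square x r :
  qform (invmx Sig) x + qform (invmx Gam) (r - H *m x) =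
  qform (invmx S) r + qform (invmx C) (x - Kg *m r).
Proof.
have [Ct _] := posdef_inv posdef_Cmx; have [Gt _] := posdef_inv posdef_Gamma.
rewrite -![qform _ _]/(bform _ _ _) !(bformDl, bformDr, bformNl, bformNr).
have e1 : bform (invmx Gam) (H *m x) r = bform (invmx C) x (Kg *m r).
  rewrite /bform [in RHS]mulmxA -(mulmxA x^T (invmx C) Kg) Cinv_Kgain.
  by rewrite trmx_mul !mulmxA.
have e2 : bform (invmx Gam) r (H *m x) = bform (invmx C) (Kg *m r) x.
  by rewrite bformC// e1 bformC.
have e3 : bform (invmx C) (Kg *m r) (Kg *m r) =
    bform (invmx Gam) r r - bform (invmx S) r r.
  rewrite /bform [(Kg *m r)^T]trmx_mul.
  have -> : r^T *m Kg^T *m invmx C *m (Kg *m r) =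
      r^T *m (Kg^T *m invmx C *m Kg) *m r.
    by move: (Kg) (invmx C) => A B; rewrite !mulmxA.
  by rewrite Kgain_Cinv_Kgain mulmxBr mulmxBl !mxE.
have e4 : bform (invmx C) x x =
    bform (invmx Sig) x x + bform (invmx Gam) (H *m x) (H *m x).
  by rewrite /bform invmx_Cmx trmx_mul mulmxDr mulmxDl !mulmxA mxE.
rewrite e1 e2 e3 e4; ring.
Qed.

End model_matrices.

(** * Image measures and translation invariance of Lebesgue measure *)

Section image_measure.
Context {d d'} {T1 : measurableType d} {T2 : measurableType d'} {R : realType}.
Variables (m : {measure set T1 -> \bar R}) (f : T1 -> T2).

(** The measure structure of a pushforward depends on the proof [mf]; bundling the two lets it be
    passed to uniqueness theorems for measures. *)
Definition image_measure (mf : measurable_fun setT f) :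
  {measure set T2 -> \bar R}.
Proof. by refine (pushforward m f : {measure set T2 -> \bar R}). Defined.

Lemma image_measureE mf A : image_measure mf A = m (f @^-1` A).
Proof. by []. Qed.

Lemma Rintegral_image (mf : measurable_fun setT f) (g : T2 -> R) :
  measurable_fun setT g -> m.-integrable setT (EFin \o (g \o f)) ->
  \int[image_measure mf]_y g y = \int[m]_x g (f x).
Proof.
move=> mg intg; rewrite /Rintegral; congr fine.
rewrite (eq_measure_integral (pushforward m f))//.
rewrite integral_pushforward//.
exact/measurable_EFinP.
Qed.

End image_measure.

Section lebesgue_translation.
Context {R : realType}.
Notation leb1 := (@lebesgue_measure R).

Lemma measurable_shift (a : R) :
  measurable_fun setT ((fun x => x + a) : measurableTypeR R -> measurableTypeR R).
Proof. by apply: measurable_funD => //; exact: measurable_cst. Qed.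

Lemma lebesgue_measure_shift (a : R) (A : set (measurableTypeR R)) :
  measurable A -> leb1 ((fun x => x + a) @^-1` A) = leb1 A.
Proof.
move=> mA; symmetry.
pose m := image_measure leb1 (measurable_shift a).
apply: (lebesgue_measure_unique (mu := m)) => [_ [[x y] _ <-]|] //=.
  rewrite /m image_measureE.
  rewrite (_ : _ @^-1` _ = `]x - a, y - a]%classic); last first.
    by apply/seteqP; split => z /=; rewrite !in_itv/= ltrBlDr lerBrDr.
  rewrite [RHS]lebesgue_measure_itv/= lebesgue_measure_itv/= !lte_fin ltrD2r.
  by case: ifP => // _; rewrite -!EFinB; congr EFin; ring.
exact: measurable_shift.
Qed.

Definition shift_cV n (a : 'cV[R]_n) (x : 'cV[R]_n) : 'cV[R]_n := x + a.

Lemma measurable_shift_cV n (a : 'cV[R]_n) : measurable_fun setT (shift_cV a).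
Proof.
apply: measurable_mxP => i j; rewrite /shift_cV.
under eq_fun do rewrite mxE.
apply: measurable_funD; [exact: measurable_mx_entry|exact: measurable_cst].
Qed.

(** Along R^(n+1) = R x R^n a translation is a product of two translations, and a measure that
    agrees with the product measure on rectangles is equal to it. *)
Lemma lebesgue_cV_shift n (a : 'cV[R]_n) (A : set 'cV[R]_n) : measurable A ->
  lebesgue_cV n (shift_cV a @^-1` A) = lebesgue_cV n A.
Proof.
elim: n a A => [|n IH] a A mA.
  by rewrite (_ : shift_cV a @^-1` A = A)//; apply/seteqP; split => x;
    rewrite /shift_cV/= (flatmx0 (x + a)) (flatmx0 x).
rewrite /= /lebesgue_cV_step /pushforward.
pose a0 := a ord0 ord0; pose a' := dsubmx (a : 'cV_(1 + n)).
pose sh (x : measurableTypeR R * 'cV[R]_n) : measurableTypeR R * 'cV[R]_n :=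
  (x.1 + a0, shift_cV a' x.2).
have msh : measurable_fun setT sh.
  apply/measurable_fun_pairP; split.
    exact: (measurableT_comp (measurable_shift a0) measurable_fst).
  exact: (measurableT_comp (measurable_shift_cV a') measurable_snd).
have mB : measurable (@cons_cV R n @^-1` A).
  by rewrite -[X in measurable X]setTI; exact: measurable_cons_cV.
rewrite (_ : @cons_cV R n @^-1` (shift_cV a @^-1` A) =
             sh @^-1` (@cons_cV R n @^-1` A)); last first.
  apply/seteqP; split => xv /=; suff -> : shift_cV a (cons_cV xv) = cons_cV (sh xv) by [];
  apply/matrixP => i j; rewrite ord1 mxE /cons_cV /sh /shift_cV;
  have [k ->|k ->] := (@split_ordP 1 n i);
  rewrite ?(@col_mxEu _ 1) ?(@col_mxEd _ 1) !mxE//;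
  by congr (_ + a _ _); apply/val_inj; rewrite //= ord1.
pose m' := image_measure (leb1 \x lebesgue_cV n)%E msh.
symmetry; apply: (product_measure_unique (m' := m')) => // B D mB' mD.
rewrite /m' image_measureE.
rewrite (_ : sh @^-1` _ = ((fun x => x + a0) @^-1` B) `*` (shift_cV a' @^-1` D))//.
rewrite [LHS](product_measure1E leb1 (lebesgue_cV n)).
- by congr (_ * _)%E; [exact: lebesgue_measure_shift|exact: IH].
- by rewrite -[X in measurable X]setTI; exact: measurable_shift.
- by rewrite -[X in measurable X]setTI; exact: measurable_shift_cV.
Qed.

(** The open ball of the sup norm: its volume follows the recursion that defines [lebesgue_cV], and
    such boxes shrink inside the neighborhoods of the matrix topology. *)
Definition box n (c : 'cV[R]_n) (e : R) : set 'cV[R]_n :=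
  [set x | forall i, `|x i 0 - c i 0| < e].

Lemma measurable_box n (c : 'cV[R]_n) e : measurable (box c e).
Proof.
rewrite (_ : box c e = \bigcap_(i in setT) [set x | `|x i 0 - c i 0| < e]); last first.
  by apply/seteqP; split => x /= h i; [move=> _|]; exact: h.
apply: fin_bigcap_measurable => // i _.
have mf : measurable_fun setT (fun x : 'cV[R]_n => `|x i 0 - c i 0|).
  apply: measurableT_comp => //; apply: measurable_funB; last exact: measurable_cst.
  exact: measurable_mx_entry.
have := mf measurableT `]-oo, e[%classic (measurable_itv _).
by rewrite setTI; congr (measurable _); apply/seteqP; split => x /=; rewrite in_itv.
Qed.

Lemma lebesgue_box n (c : 'cV[R]_n) e : 0 < e ->
  lebesgue_cV n (box c e) = ((2 * e) ^+ n)%:E.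
Proof.
move=> e0; elim: n c => [|n IH] c.
  by rewrite /= diracE mem_set//= => -[].
rewrite /= /lebesgue_cV_step /pushforward.
pose c' := dsubmx (c : 'cV_(1 + n)).
rewrite (_ : @cons_cV R n @^-1` _ = ball (c ord0 ord0) e `*` box c' e); last first.
  apply/seteqP; split => -[x v]; rewrite /box /cons_cV/=.
    move=> h; split.
      rewrite /ball/= distrC; have := h (@lshift 1 n ord0).
      by rewrite (@col_mxEu _ 1) mxE (_ : @lshift 1 n ord0 = ord0)//; exact/val_inj.
    by move=> i; have := h (@rshift 1 n i); rewrite (@col_mxEd _ 1) mxE.
  rewrite /ball/= => -[h1 h2] i; have [j ->|j ->] := (@split_ordP 1 n i).
    by rewrite (@col_mxEu _ 1) mxE distrC ord1 (_ : @lshift 1 n 0 = ord0)//; exact/val_inj.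
  by rewrite (@col_mxEd _ 1); have := h2 j; rewrite mxE.
rewrite [LHS](product_measure1E leb1 (lebesgue_cV n)).
- rewrite exprS EFinM; congr (_ * _)%E; last exact: IH.
  by rewrite mulr_natl; apply: lebesgue_measure_ball; exact: ltW.
- exact: measurable_ball.
- exact: measurable_box.
Qed.

Lemma Rintegral_shift n (a : 'cV[R]_n) (f : 'cV[R]_n -> R) :
  (lebesgue_cV n).-integrable setT (EFin \o f) ->
  \int[lebesgue_cV n]_x f (x + a) = \int[lebesgue_cV n]_x f x.
Proof.
move=> intf.
pose m := image_measure (lebesgue_cV n) (measurable_shift_cV a).
have mE A : measurable A -> m A = lebesgue_cV n A by exact: lebesgue_cV_shift.
have mf : measurable_fun setT f by case/integrableP : intf => /measurable_EFinP.
have -> : \int[lebesgue_cV n]_x f x = \int[m]_x f x.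
  by rewrite /Rintegral; congr fine; apply: eq_measure_integral => A mA _; rewrite mE.
rewrite Rintegral_image//; apply/integrableP; split.
  apply/measurable_EFinP; apply: measurableT_comp => //; exact: measurable_shift_cV.
have := ge0_integral_pushforward (measurable_shift_cV a) (lebesgue_cV n) (D := setT)
  (f := fun x => `|(f x)%:E|%E) measurableT.
rewrite preimage_setT => <-//; last first.
  by apply: measurableT_comp => //; exact/measurable_EFinP.
rewrite (eq_measure_integral (lebesgue_cV n)).
  by case/integrableP : intf.
  exact: measurable_shift_cV.
by move=> mm A mA _; exact: mE.
Qed.

End lebesgue_translation.

(** * Measures with a density, and Gaussian laws *)

Section density.
Context {d} {T : measurableType d} {R : realType}.
Variables (m : {measure set T -> \bar R}) (pr : T -> R).
Hypothesis intp : m.-integrable setT (EFin \o pr).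

Let mp : measurable_fun setT pr.
Proof. by case/integrableP : intp => /measurable_EFinP. Qed.

Lemma bfunM_integrable f : bfun f ->
  m.-integrable setT (EFin \o (fun x => f x * pr x)).
Proof.
move=> [mf [c fc]].
apply: (@le_integrable _ _ _ m setT measurableT _ (fun x => c%:E * (pr x)%:E)%E).
- by apply/measurable_EFinP; exact: measurable_funM.
- move=> x _ /=; rewrite lee_fin !normrM ler_wpM2r//.
  by rewrite (le_trans (fc x))// ler_norm.
- exact: integrableZl.
Qed.

Lemma daniell_density : daniell (fun f => \int[m]_x (f x * pr x)).
Proof.
split.
  move=> a f g bf bg; rewrite -RintegralZl//; last exact: bfunM_integrable.
  rewrite -RintegralD//; last exact: bfunM_integrable.
    by apply: eq_Rintegral => x _; rewrite mulrDl mulrA.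
  under [X in _.-integrable _ (_ \o X)]eq_fun do rewrite mulrA.
  by apply: bfunM_integrable; exact: bfunZ.
move=> h f c bh bf hc hf.
have [] := @dominated_convergence _ _ _ m setT measurableT
  (fun n x => (h n x * pr x)%:E) (fun x => (f x * pr x)%:E) (fun x => `|c%:E * (pr x)%:E|%E).
- by move=> n; apply/measurable_EFinP; apply: measurable_funM => //; case: (bh n).
- by apply/measurable_EFinP; apply: measurable_funM => //; case: bf.
- apply: aeW => x _ /=; apply: cvg_EFin; first exact: nearW.
  by apply: cvgMr_tmp; exact: hf.
- by apply: integrable_abse; exact: integrableZl.
- apply: aeW => x n _ /=; rewrite lee_fin !normrM ler_wpM2r//.
  by rewrite (le_trans (hc n x))// ler_norm.
- move=> _ _.
  have fE g : bfun g -> (\int[m]_x (g x * pr x)%:E)%E = (\int[m]_x (g x * pr x))%:E.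
    by move=> bg; rewrite /Rintegral fineK//; apply: integrable_fin_num => //; exact: bfunM_integrable.
  by under eq_fun do rewrite fE//; rewrite fE// => /fine_cvgP[].
Qed.

Lemma Rintegral_density (g : {measure set T -> \bar R}) : (g setT < +oo)%E ->
  (forall A, measurable A -> g A = (\int[m]_(x in A) (pr x)%:E)%E) ->
  forall f, bfun f -> \int[g]_x f x = \int[m]_x (f x * pr x).
Proof.
move=> goo gE; apply: mclass_measurable.
  exact: mclass_eq (daniell_Rintegral goo) daniell_density.
move=> A mA; rewrite Rintegral_indic// gE// [LHS]Rintegral_mkcond.
apply: eq_Rintegral => x _; rewrite patchE indicE.
by case: (x \in A); rewrite (mul1r, mul0r).
Qed.

End density.

Section gaussian_density.
Context {R : realType}.

Section one.
Variables (n : nat) (A : 'M[R]_n).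
Hypothesis pA : posdef A.

Definition gauss_peak : R := (Num.sqrt ((2 * pi) ^+ n * \det A))^-1.

Lemma gauss_pdfE x : gauss_pdf A x = expR (- (wnorm A x ^+ 2 / 2)) * gauss_peak.
Proof. by []. Qed.

Lemma gauss_peak_ge0 : 0 <= gauss_peak. Proof. by rewrite invr_ge0 sqrtr_ge0. Qed.

Lemma gauss_pdf_ge0 x : 0 <= gauss_pdf A x.
Proof. by rewrite gauss_pdfE mulr_ge0 ?expR_ge0 ?gauss_peak_ge0. Qed.

Lemma expR_wnorm_le1 x : expR (- (wnorm A x ^+ 2 / 2)) <= 1.
Proof. by rewrite -expR0 ler_expR oppr_le0 divr_ge0// sqr_ge0. Qed.

Lemma gauss_pdf_le x : gauss_pdf A x <= gauss_peak.
Proof. by rewrite gauss_pdfE ler_piMl ?gauss_peak_ge0 ?expR_wnorm_le1. Qed.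

Lemma continuous_expR_wnorm : continuous (fun x => expR (- (wnorm A x ^+ 2 / 2))).
Proof.
move=> x.
have cq : qform (invmx A) z @[z --> x] --> qform (invmx A) x.
  under eq_fun do rewrite qformE; rewrite qformE.
  apply: (@cvgr_sum _ _ _ (nbhs x)) => i; apply: (@cvgr_sum _ _ _ (nbhs x)) => j; apply: cvgMl_tmp.
  by apply: cvgM; exact: coord_continuous.
have ce : qform (invmx A) z * - 2^-1 @[z --> x] --> qform (invmx A) x * - 2^-1.
  exact: (cvgMr_tmp cq).
rewrite (_ : (fun _ => _) = fun z => expR (qform (invmx A) z * - 2^-1)); last first.
  by apply/funext => z; rewrite wnorm_sqr// mulrN.
exact: (cvg_comp _ _ ce (@continuous_expR R _)).
Qed.

Lemma measurable_expR_wnorm : measurable_fun setT (fun x => expR (- (wnorm A x ^+ 2 / 2))).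
Proof.
apply: measurableT_comp; first exact: measurable_expR.
apply: measurable_funN; apply: measurable_funM; last exact: measurable_cst.
under eq_fun do rewrite wnorm_sqr// qformE.
apply: measurable_sum => i; apply: measurable_sum => j.
apply: measurable_funM; first exact: measurable_cst.
by apply: measurable_funM; exact: measurable_mx_entry.
Qed.

Lemma continuous_gauss_pdf : continuous (gauss_pdf A).
Proof. by move=> x; exact: (cvgMr_tmp (@continuous_expR_wnorm x)). Qed.

Lemma bfun_expR_wnorm : bfun (fun x => expR (- (wnorm A x ^+ 2 / 2))).
Proof.
split; first exact: measurable_expR_wnorm.
by exists 1 => x; rewrite ger0_norm ?expR_ge0// expR_wnorm_le1.
Qed.

Lemma bfun_gauss_pdf : bfun (gauss_pdf A).
Proof. by apply: bfunM; [exact: bfun_expR_wnorm|exact: bfun_cst]. Qed.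

Variable g : probability 'cV[R]_n R.
Hypothesis gE : forall B, measurable B -> g B = gauss A B.

(* A nonpositive determinant would make the density vanish (sqrt is 0 there, and
   1 / 0 = 0), contradicting total mass 1: no Gaussian integral is computed. *)
Lemma gauss_peak_gt0 : 0 < gauss_peak.
Proof.
rewrite lt0r gauss_peak_ge0 andbT; apply/negP => /eqP z0.
have := gE measurableT; rewrite probability_setT /gauss.
under eq_integral do rewrite gauss_pdfE z0 mulr0.
by rewrite integral0 => /eqP; rewrite onee_eq0.
Qed.

(** The integral of the nonnegative density is the total mass of [g], that is 1. *)
Lemma gauss_pdf_integrable : (lebesgue_cV n).-integrable setT (EFin \o gauss_pdf A).
Proof.
apply/integrableP; split; first by apply/measurable_EFinP; case: bfun_gauss_pdf.
under eq_integral do rewrite /= ger0_norm ?gauss_pdf_ge0//.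
by have := gE measurableT; rewrite probability_setT /gauss => <-; rewrite ltry.
Qed.

Lemma Rintegral_gauss (f : 'cV[R]_n -> R) : bfun f ->
  \int[g]_x f x = \int[lebesgue_cV n]_x (f x * gauss_pdf A x).
Proof.
apply: Rintegral_density; first exact: gauss_pdf_integrable.
  exact: probability_ltoo.
exact: gE.
Qed.

Lemma Rintegral_gauss_shift (f : 'cV[R]_n -> R) (a : 'cV[R]_n) : bfun f ->
  \int[g]_x f (x + a) = \int[lebesgue_cV n]_x (f x * gauss_pdf A (x - a)).
Proof.
move=> bf; have bfa : bfun (fun x : 'cV[R]_n => f (x + a)).
  exact: (bfun_comp (measurable_shift_cV a)).
rewrite [LHS](Rintegral_gauss bfa).
have e := Rintegral_shift (- a) (bfunM_integrable gauss_pdf_integrable bfa).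
apply: etrans (esym e) _; apply: eq_Rintegral => x _; congr (f _ * _).
exact: subrK.
Qed.

Lemma gauss_box_le c e h l u : 0 < e ->
  (forall x, box c e x -> l <= gauss_pdf A (x - h) <= u) ->
  l * (2 * e) ^+ n <= \int[g]_x \1_(box c e) (x + h) <= u * (2 * e) ^+ n.
Proof.
move=> e0 lu; have mb := measurable_box c e.
have Lb : (lebesgue_cV n (box c e) < +oo)%E by rewrite lebesgue_box// ltry.
rewrite Rintegral_gauss_shift; last exact: bfun_indic.
have -> : \int[lebesgue_cV n]_x (\1_(box c e) x * gauss_pdf A (x - h)) =
    \int[lebesgue_cV n]_(x in box c e) gauss_pdf A (x - h).
  rewrite [RHS]Rintegral_mkcond; apply: eq_Rintegral => x _; rewrite patchE indicE.
  by case: (x \in _); rewrite (mul1r, mul0r).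
have bpdf : bfun (fun x : 'cV[R]_n => gauss_pdf A (x - h)).
  exact: (bfun_comp (measurable_shift_cV (- h)) bfun_gauss_pdf).
have int (f : 'cV[R]_n -> R) : bfun f -> (lebesgue_cV n).-integrable (box c e) (EFin \o f).
  move=> [mf [b fb]]; apply: measurable_bounded_integrable => //.
    exact: measurable_funTS.
  exists b; split; first exact: num_real.
  by move=> y by_ x _; exact: le_trans (fb x) (ltW by_).
have vE k : k * (2 * e) ^+ n = \int[lebesgue_cV n]_(x in box c e) k.
  rewrite Rintegral_cst//; congr (_ * _).
  exact: esym (congr1 fine (lebesgue_box c e0)).
rewrite !vE; apply/andP; split; apply: le_Rintegral => //.
- exact: int (bfun_cst l).
- exact: int.
- by move=> x /lu /andP[].
- exact: int.
- exact: int (bfun_cst u).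
- by move=> x /lu /andP[].
Qed.

(** Differentiation of the law at a point of continuity of its density: on a small enough box the
    density is within [eps] of its central value. *)
Lemma gauss_box_cvg c h :
  (\int[g]_x \1_(box c k.+1%:R^-1) (x + h)) / (2 * k.+1%:R^-1) ^+ n
    @[k --> \oo] --> gauss_pdf A (c - h).
Proof.
apply/cvgrPdist_le => eps eps0.
have /cvgrPdist_le/(_ _ eps0)/nbhs_ballP[r /= r0 rh] := @continuous_gauss_pdf (c - h).
near=> k.
have k0 : 0 < k.+1%:R^-1 :> R by rewrite invr_gt0 ltr0n.
have kr : k.+1%:R^-1 < r by near: k; exact: near_infty_natSinv_lt (PosNum r0).
have v0 : 0 < (2 * k.+1%:R^-1) ^+ n :> R by rewrite exprn_gt0// mulr_gt0.
have /andP[h1 h2] : (gauss_pdf A (c - h) - eps) * (2 * k.+1%:R^-1) ^+ n <=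
    \int[g]_x \1_(box c k.+1%:R^-1) (x + h) <=
    (gauss_pdf A (c - h) + eps) * (2 * k.+1%:R^-1) ^+ n.
  apply: gauss_box_le => // x bx.
  have : ball (c - h) r (x - h).
    split=> // i j; rewrite ord1 !mxE /ball/=.
    have -> : c i 0 - h i 0 - (x i 0 - h i 0) = c i 0 - x i 0 by ring.
    by rewrite distrC; exact: lt_trans (bx i) kr.
  by move=> /rh /=; rewrite ler_distlC.
by rewrite ler_distlC ler_pdivlMr// ler_pdivrMr// h1 h2.
Unshelve. all: by end_near. Qed.

(** The bound depends neither on the box nor on [h]; it is the domination that [hit_cvg] needs. *)
Lemma gauss_box_bound c h e : 0 < e ->
  0 <= (\int[g]_x \1_(box c e) (x + h)) / (2 * e) ^+ n <= gauss_peak.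
Proof.
move=> e0.
have v0 : 0 < (2 * e) ^+ n :> R by rewrite exprn_gt0// mulr_gt0.
rewrite ler_pdivlMr// ler_pdivrMr//; apply: gauss_box_le => // x _.
by rewrite gauss_pdf_ge0 gauss_pdf_le.
Qed.

End one.

Section update.
Variables (p q : nat) (M : model R p q).
Local Notation H := (obsop M).
Variables (gS gC : probability 'cV[R]_p R) (gG : probability 'cV[R]_q R).
Hypothesis gSE : forall B, measurable B -> gS B = gauss (Sigma M) B.
Hypothesis gCE : forall B, measurable B -> gC B = gauss (Cmx M) B.
Hypothesis gGE : forall B, measurable B -> gG B = gauss (Gamma M) B.

(** The factor left by completing the square. It depends on neither state nor observation, so it
    cancels when the filter is normalized and its value is never computed. *)
Definition update_cst : R :=
  gauss_peak (Sigma M) * gauss_peak (Gamma M) / gauss_peak (Cmx M).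

Lemma update_cst_gt0 : 0 < update_cst.
Proof. by rewrite divr_gt0 ?mulr_gt0 ?(gauss_peak_gt0 gSE) ?(gauss_peak_gt0 gCE) ?(gauss_peak_gt0 gGE). Qed.

Lemma gauss_pdf_complete_square x r :
  gauss_pdf (Sigma M) x * gauss_pdf (Gamma M) (r - H *m x) =
  update_cst * expR (- (wnorm (Smx M) r ^+ 2 / 2)) *
  gauss_pdf (Cmx M) (x - Kgain M *m r).
Proof.
have C0 : gauss_peak (Cmx M) != 0 by rewrite gt_eqF// (gauss_peak_gt0 gCE).
have E : expR (- (wnorm (Sigma M) x ^+ 2 / 2)) *
    expR (- (wnorm (Gamma M) (r - H *m x) ^+ 2 / 2)) =
    expR (- (wnorm (Smx M) r ^+ 2 / 2)) *
    expR (- (wnorm (Cmx M) (x - Kgain M *m r) ^+ 2 / 2)).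
  rewrite -!expRD; congr expR; rewrite -!opprD -!mulrDl; congr (- (_ / _)).
  rewrite !wnorm_sqr; first exact: qform_complete_square.
  - exact: posdef_Cmx.
  - exact: posdef_Smx.
  - exact: posdef_Gamma.
  - exact: posdef_Sigma.
rewrite !gauss_pdfE mulrACA E /update_cst; by field.
Qed.

(** Why the filter has its weights and its proposal: moving the signal from [v] and weighting by the
    likelihood of [y] equals weighting [v] first and then drawing from the proposal. The square is
    completed in the product of the two densities. *)
Lemma gauss_update (f : 'cV[R]_p -> R) (v : 'cV[R]_p) (y : 'cV[R]_q) : bfun f ->
  \int[gS]_x (f (v + x) * gauss_pdf (Gamma M) (y - H *m (v + x))) =
  update_cst * expR (- (wnorm (Smx M) (y - H *m v) ^+ 2 / 2)) *
  \int[gC]_z f ((1%:M - Kgain M *m H) *m v + Kgain M *m y + z).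
Proof.
move=> bf; set r := y - H *m v; set a := _ + _ *m y.
(* The proposal mean is the prediction [v] corrected by the gain times the innovation [r], which is
   where the Gaussian of covariance [Cmx M] is centered. *)
have aE : a = v + Kgain M *m r.
  by rewrite /a /r mulmxBl mul1mx mulmxBr mulmxA -!addrA; congr (_ + _); rewrite addrC.
have bshift b : bfun (fun x : 'cV[R]_p => f (b + x)).
  by under eq_fun do rewrite addrC; exact: (bfun_comp (measurable_shift_cV b)).
have mr : measurable_fun setT (fun x : 'cV[R]_p => r - H *m x).
  apply: measurable_mxP => i j; under eq_fun do rewrite !mxE.
  apply: measurable_funB; first exact: measurable_cst.
  apply: measurable_sum => k; apply: measurable_funM; first exact: measurable_cst.
  exact: measurable_mx_entry.
have bG : bfun (fun x : 'cV[R]_p => gauss_pdf (Gamma M) (r - H *m x)).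
  exact: (bfun_comp mr (bfun_gauss_pdf (posdef_Gamma M))).
transitivity (\int[gS]_x (f (v + x) * gauss_pdf (Gamma M) (r - H *m x))).
  by apply: eq_Rintegral => x _; rewrite /r mulmxDr opprD addrA.
rewrite (Rintegral_gauss (posdef_Sigma M) gSE); last exact: bfunM.
set k := update_cst * _.
rewrite -(bfun_RintegralZ (probability_ltoo gC)); last exact: bshift.
transitivity (\int[gC]_x (k * f (v + (x + Kgain M *m r)))); last first.
  by apply: eq_Rintegral => x _; rewrite aE addrAC addrA.
rewrite (Rintegral_gauss_shift (posdef_Cmx M) gCE (Kgain M *m r) (bfunZ k (bshift v))).
apply: eq_Rintegral => x _.
rewrite -mulrA [gauss_pdf _ _ * gauss_pdf _ _]mulrC gauss_pdf_complete_square -/k.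
by rewrite mulrCA mulrA.
Qed.

End update.

End gaussian_density.

(** * Error propagation in the optimal particle filter *)

Section iid_given_lemmas.
Context {d d'} {Om : measurableType d} {T : measurableType d'} {R : realType}.
Variables (P : probability Om R) (F : set (set Om)).
Variables (nu : Om -> {measure set T -> \bar R}) (N : nat) (X : 'I_N -> Om -> T).
Hypothesis nu1 : forall w, nu w setT = 1%E.
Hypothesis iidX : iid_given P F nu X.

(** All indices other than [n] and [m] are tested against [setT], whose factors are 1 by [nu1]. *)
Lemma iid_given_pair E B B' n m : F E -> measurable B -> measurable B' -> n != m ->
  P (E `&` (X n @^-1` B `&` X m @^-1` B')) = (\int[P]_(w in E) (nu w B * nu w B'))%E.
Proof.
move=> FE mB mB' nm.
pose D i := if i == n then B else if i == m then B' else setT.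
have mD i : measurable (D i) by rewrite /D; case: ifP => // _; case: ifP.
have := iidX FE mD.
have -> : \bigcap_i (X i @^-1` D i) = X n @^-1` B `&` X m @^-1` B'.
  apply/seteqP; split => w /=.
    move=> h; have := h n I; have := h m I.
    by rewrite /D !eqxx eq_sym (negbTE nm).
  move=> [h1 h2] i _; rewrite /D /=.
  by case: eqP => [->//|_]; case: eqP => [->//|].
move=> ->; apply: eq_integral => w _.
rewrite (bigD1 n)//= (bigD1 m) 1?eq_sym//= big1 ?mule1.
  by rewrite /D !eqxx eq_sym (negbTE nm).
by move=> i /andP[ni mi]; rewrite /D (negbTE ni) (negbTE mi) nu1.
Qed.

Lemma iid_given_single E B n : F E -> measurable B ->
  P (E `&` X n @^-1` B) = (\int[P]_(w in E) nu w B)%E.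
Proof.
move=> FE mB.
pose D i := if i == n then B else setT.
have mD i : measurable (D i) by rewrite /D; case: ifP.
have := iidX FE mD.
have -> : \bigcap_i (X i @^-1` D i) = X n @^-1` B.
  apply/seteqP; split => w /=; first by move=> /(_ n I); rewrite /D eqxx.
  by move=> h i _; rewrite /D /=; case: eqP => [->|].
move=> ->; apply: eq_integral => w _.
rewrite (bigD1 n)//= big1 ?mule1 /D ?eqxx//.
by move=> i ni; rewrite (negbTE ni) nu1.
Qed.

Lemma prob_fineK w B : measurable B -> nu w B = (fine (nu w B))%:E.
Proof.
move=> mB; rewrite fineK// ge0_fin_numE//.
apply: (@le_lt_trans _ _ (nu w setT)); last by rewrite nu1 ltry.
by apply: le_measure; rewrite ?subsetT// mem_set.
Qed.

End iid_given_lemmas.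

Lemma Rintegral_indic_mul d (T : measurableType d) (R : realType)
    (m : {measure set T -> \bar R}) (E : set T) (f : T -> R) :
  \int[m]_x (\1_E x * f x) = \int[m]_(x in E) f x.
Proof.
rewrite [RHS]Rintegral_mkcond; apply: eq_Rintegral => x _; rewrite patchE indicE.
by case: (x \in E); rewrite (mul1r, mul0r).
Qed.

Lemma markov_comp d1 d2 d3 (S : measurableType d1) (T : measurableType d2)
    (U : measurableType d3) (R : realType)
    (A : (T -> R) -> S -> R) (B : (U -> R) -> T -> R) :
  markov_op A -> markov_op B -> markov_op (fun f => A (B f)).
Proof.
move=> mA mB; split.
- by move=> f bf; exact/(markov_bfun mA)/(markov_bfun mB).
- move=> f c bf fc s; apply: (markov_bound mA); first exact: (markov_bfun mB).
  exact: (markov_bound mB).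
- by move=> s; exact: (daniell_markov (markov_daniell mA s) mB).
Qed.

(** Averages over a noise that is independent of [s]; measurability in [s] is checked on
    rectangles. *)
Lemma markov_slice d1 d2 (S : measurableType d1) (T : measurableType d2)
    (R : realType) (g : probability T R) :
  markov_op (fun (f : S * T -> R) s => \int[g]_z f (s, z)).
Proof.
have goo := probability_ltoo g.
have mpair (s : S) : measurable_fun setT (fun z : T => (s, z)).
  by apply/measurable_fun_pairP; split; [exact: measurable_cst|exact: measurable_id].
have dg s : daniell (fun f : S * T -> R => \int[g]_z f (s, z)).
  exact: (daniell_pull (daniell_Rintegral goo) (mpair s)).
have bg (f : S * T -> R) c s : bfun f -> (forall x, `|f x| <= c) -> `|\int[g]_z f (s, z)| <= c.
  move=> bf fc; have bfs : bfun (fun z => f (s, z)) by exact: (bfun_comp (mpair s)).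
  have := daniell_norm_le goo bfs (fun z => fc (s, z)).
  by rewrite (_ : fine _ = 1) ?mulr1//; exact: (congr1 fine (probability_setT g)).
split => //; last by move=> f c bf fc s; exact: bg.
move=> f bf; split; last by have [_ [c fc]] := bf; exists c => s; exact: bg.
move: f bf; apply: (mclass_prod (measurable_daniell dg)) => A B mA mB.
have e s : \int[g]_z (\1_A s * \1_B z) = \1_A s * fine (g B).
  by rewrite (bfun_RintegralZ goo) ?Rintegral_indic//; exact: bfun_indic.
under eq_fun do rewrite e.
by apply: measurable_funM; [exact: measurable_indic|exact: measurable_cst].
Qed.

Lemma measurable_mulmx d (T : measurableType d) (R : realType) m n
    (A : 'M[R]_(m, n)) (f : T -> 'cV[R]_n) :
  measurable_fun setT f -> measurable_fun setT (fun x => A *m f x).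
Proof.
move=> mf; apply: measurable_mxP => i j; under eq_fun do rewrite mxE.
apply: measurable_sum => k; apply: measurable_funM; first exact: measurable_cst.
exact: (measurableT_comp (measurable_mx_entry k j)).
Qed.

Lemma measurable_addmx d (T : measurableType d) (R : realType) m n
    (f g : T -> 'M[R]_(m, n)) : measurable_fun setT f -> measurable_fun setT g ->
  measurable_fun setT (fun x => f x + g x).
Proof.
move=> mf mg; apply: measurable_mxP => i j; under eq_fun do rewrite mxE.
by apply: measurable_funD; exact: (measurableT_comp (measurable_mx_entry i j)).
Qed.

Section wdirac_integral.
Context {d} {T : measurableType d} {R : realType} (N : nat).
Variables (w : 'I_N -> {nonneg R}) (x : 'I_N -> T).

Lemma wdirac_setT : wdirac w x setT = (\sum_(n < N) (w n)%:num)%:E.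
Proof.
rewrite /wdirac -sumEFin; apply: eq_bigr => n _.
by rewrite diracT mule1.
Qed.

Lemma Rintegral_wdirac f : bfun f ->
  \int[wdirac w x]_z f z = \sum_(n < N) (w n)%:num * f (x n).
Proof.
have oo : (wdirac w x setT < +oo)%E by rewrite wdirac_setT ltry.
move: f; apply: mclass_measurable.
  apply: mclass_eq; first exact: daniell_Rintegral.
  by apply: daniell_sum => n; apply: daniellZ; exact: daniell_eval.
move=> A mA; rewrite Rintegral_indic//.
transitivity (fine (\sum_(n < N) ((w n)%:num * \1_A (x n))%:E)%E).
  by congr fine; apply: eq_bigr => n _; rewrite EFinM.
by rewrite sumEFin.
Qed.

End wdirac_integral.

Section particle_filter.
Context {R : realType} {p q : nat} (M : model R p q) (K N : nat).
Hypotheses (K_gt0 : (0 < K)%N) (N_gt0 : (0 < N)%N).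
Context {d} {Om : measurableType d} (P : probability Om R).
Variables (y : nat -> 'cV[R]_q) (u zeta : nat -> 'I_N -> {RV P >-> 'cV[R]_p}).
Hypothesis opfP : optimal_particle_filter M y u zeta K.

Let Poo := probability_ltoo P.

(** The generators of [opf_past], named so that [g_sigma_algebraType] turns [Om] with the past into
    a measurable space of its own. *)
Definition opf_gen k l : set (set Om) :=
  [set E | (exists j n B, [/\ (j < k)%N, measurable B & E = u j n @^-1` B]) \/
           (exists j n B, [/\ (j < l)%N, measurable B & E = zeta j n @^-1` B])].

Lemma opf_gen_measurable k l : opf_gen k l `<=` measurable.
Proof.
by move=> E [|] [j [n [B [_ mB ->]]]]; rewrite -[X in measurable X]setTI;
  exact: measurable_funPT.
Qed.

Lemma measurable_u_past k l j n : (j < k)%N ->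
  measurable_fun setT (u j n : g_sigma_algebraType (opf_gen k l) -> _).
Proof.
move=> jk _ B mB; rewrite setTI; apply: sub_sigma_algebra.
by left; exists j, n, B.
Qed.

Lemma measurable_zeta_past k l j n : (j < l)%N ->
  measurable_fun setT (zeta j n : g_sigma_algebraType (opf_gen k l) -> _).
Proof.
move=> jk _ B mB; rewrite setTI; apply: sub_sigma_algebra.
by right; exists j, n, B.
Qed.

Lemma opf_genS k l : opf_gen k l `<=` opf_gen k.+1 l.
Proof.
by move=> E [|] [j [n [B [jk mB ->]]]]; [left|right]; exists j, n, B; split=> //;
  exact: ltnW.
Qed.

Lemma opf_past_setT k l : opf_past u zeta k l setT.
Proof. exact: (@measurableT _ (g_sigma_algebraType (opf_gen k l))). Qed.

Let n0 := Ordinal N_gt0.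

(** [gauss (Cmx M)] is only a set function; the law of one proposal noise realizes it as a
    probability. The noise [zeta 0 n0] exists because [K] and [N] are positive. *)
Definition gC : probability 'cV[R]_p R := distribution P (zeta 0 n0).

Lemma opf_noise_cst k (B : 'I_N -> set 'cV[R]_p) : (k < K)%N ->
  (forall n, measurable (B n)) ->
  P (\bigcap_n (zeta k n @^-1` B n)) = (\big[mule/1]_(n < N) gauss (Cmx M) (B n))%E.
Proof.
move=> kK mB; have := opf_noise opfP kK (@opf_past_setT _ _) mB.
rewrite setTI => ->; rewrite integral_cst// [X in (_ * X)%E](_ : _ = 1%E) ?mule1//.
exact: probability_setT.
Qed.

(** The joint law of the [N] noises has mass 1, so the [N]-th power of this nonnegative number is 1;
    that excludes [+oo] and leaves 1 because [N > 0]. *)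
Lemma gauss_Cmx_setT : gauss (Cmx M) setT = 1%E.
Proof.
have g0 : (0 <= gauss (Cmx M) setT)%E.
  by apply: integral_ge0 => x _; rewrite lee_fin gauss_pdf_ge0.
have := @opf_noise_cst 0 (fun=> setT) K_gt0 (fun=> measurableT).
rewrite (_ : \bigcap_n _ = setT); last by apply/seteqP; split.
rewrite (_ : P _ = 1%E); last exact: probability_setT.
rewrite big_const_ord.
case: (gauss _ _) g0 => [r| |]//; last first.
  rewrite -(prednK N_gt0) (_ : iter _ _ _ = +oo%E)//.
  by elim: N.-1 => [|n IH]; rewrite iterS ?mule1// IH mulyy.
rewrite lee_fin => r0; rewrite (_ : iter _ _ _ = (r ^+ N)%:E); last first.
  by elim: (N) => [//|n IH]; rewrite iterS IH exprS EFinM.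
by move=> [] /esym/eqP; rewrite pexpr_eq1// => /eqP ->.
Qed.

Lemma gCE B : measurable B -> gC B = gauss (Cmx M) B.
Proof.
move=> mB; pose D i := if i == n0 then B else setT.
have mD i : measurable (D i) by rewrite /D; case: ifP.
have := opf_noise_cst K_gt0 mD.
rewrite (bigD1 n0)//= big1 ?mule1 => [|i /negbTE ni]; last by rewrite /D ni gauss_Cmx_setT.
rewrite {2}/D eqxx => <-; congr (P _).
apply/seteqP; split => w /=.
  by move=> h i _; rewrite /D /=; case: eqP => [->|].
by move=> /(_ n0 I); rewrite /D eqxx.
Qed.

Lemma opf_noise_gC k : (k < K)%N ->
  iid_given P (opf_past u zeta k.+1 k) (fun=> gC) (fun n => zeta k n).
Proof.
move=> kK E B FE mB; rewrite (opf_noise opfP kK FE mB).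
by apply: eq_integral => w _; apply: eq_bigr => n _; rewrite gCE.
Qed.

(** The initial draw counts as a resampling from [opf_weighted 0], which is [mu0]; later arguments
    need no separate case for [k = 0]. *)
Lemma opf_iid k : (k <= K)%N ->
  iid_given P (opf_past u zeta k k) (opf_weighted M y u zeta k) (fun n => u k n).
Proof.
case: k => [_|k kK]; first exact: (opf_init opfP).
exact: (opf_resample opfP kK).
Qed.

Definition ws k (v : 'cV[R]_p) : R :=
  expR (- (wnorm (Smx M) (y k.+1 - obsop M *m psi M v) ^+ 2 / 2)).

Definition wprop k (v : 'cV[R]_p) : 'cV[R]_p :=
  (1%:M - Kgain M *m obsop M) *m psi M v + Kgain M *m y k.+1.

Lemma bfun_ws k : bfun (ws k).
Proof.
have mr : measurable_fun setT (fun v => y k.+1 - obsop M *m psi M v).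
  apply: measurable_addmx; first exact: measurable_cst.
  under eq_fun do rewrite -mulNmx.
  by apply: measurable_mulmx; exact: psi_meas.
exact: (bfun_comp mr (bfun_expR_wnorm (posdef_Smx M))).
Qed.

Lemma measurable_wprop k : measurable_fun setT (wprop k).
Proof.
apply: measurable_addmx; last exact: measurable_cst.
by apply: measurable_mulmx; exact: psi_meas.
Qed.

Lemma ws_gt0 k v : 0 < ws k v. Proof. exact: expR_gt0. Qed.

Lemma ws_le1 k v : `|ws k v| <= 1.
Proof. by rewrite ger0_norm ?expR_ge0//; exact: expR_wnorm_le1. Qed.

Lemma sum_ws_gt0 k (v : 'I_N -> 'cV[R]_p) : 0 < \sum_(n < N) ws k (v n).
Proof.
rewrite (bigD1 n0)//= ltr_pwDl ?ws_gt0// sumr_ge0// => i _; exact/ltW/ws_gt0.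
Qed.

Lemma opf_weighted_setT k w : opf_weighted M y u zeta k w setT = 1%E.
Proof.
case: k => [|k]; first exact: probability_setT.
rewrite [LHS]wdirac_setT /=; congr EFin; rewrite -mulr_suml divff//.
by rewrite gt_eqF//; exact: (@sum_ws_gt0 k).
Qed.

(** Typed on the past before resampling at step [k]: this is the conditional expectation of
    [f (u k n)] given that past. *)
Definition opf_op k (f : 'cV[R]_p -> R) (w : g_sigma_algebraType (opf_gen k k)) : R :=
  \int[opf_weighted M y u zeta k w]_x f x.

Arguments opf_op : clear implicits.

Lemma opf_opS k (f : 'cV[R]_p -> R) w : bfun f -> opf_op k.+1 f w =
  \sum_(n < N) ws k (u k n w) / (\sum_(m < N) ws k (u k m w)) *
    f (wprop k (u k n w) + zeta k n w).
Proof. by move=> bf; rewrite /opf_op Rintegral_wdirac. Qed.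

Lemma markov_opf_op k : markov_op (opf_op k).
Proof.
apply: markov_kernel; last by move=> w; exact: opf_weighted_setT.
case: k => [|k] U mU.
  exact: measurable_cst.
have e w : opf_weighted M y u zeta k.+1 w U = (opf_op k.+1 \1_U w)%:E.
  rewrite /opf_op Rintegral_indic//.
  exact: (prob_fineK (opf_weighted_setT k.+1) w mU).
under eq_fun do rewrite e (opf_opS _ (bfun_indic mU)).
apply/measurable_EFinP; apply: measurable_sum => n.
have mu j : measurable_fun setT (u k j : g_sigma_algebraType (opf_gen k.+1 k.+1) -> _).
  exact: measurable_u_past.
have mws j : measurable_fun setT (fun w : g_sigma_algebraType (opf_gen k.+1 k.+1) => ws k (u k j w)).
  by apply: (measurableT_comp _ (mu j)); case: (bfun_ws k).
apply: measurable_funM.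
  apply: measurable_funM => //.
  (* The sum of weights is positive, so its inverse is an exponential of minus a logarithm, both
     measurable. *)
  rewrite (_ : (fun w => _) = fun w => expR (- ln (\sum_(m < N) ws k (u k m w)))).
    apply: measurableT_comp; first exact: measurable_expR.
    apply: measurable_funN; apply: measurableT_comp; first exact: measurable_ln.
    exact: measurable_sum.
  by apply/funext => w; rewrite expRN lnK// posrE (@sum_ws_gt0 k).
apply: measurableT_comp; first exact: measurable_indic.
apply: measurable_addmx; last exact: measurable_zeta_past.
exact: (measurableT_comp (measurable_wprop k) (mu n)).
Qed.

Lemma opf_op_indic k B w : measurable B ->
  opf_op k \1_B w = fine (opf_weighted M y u zeta k w B).
Proof. by move=> mB; rewrite /opf_op Rintegral_indic. Qed.

Lemma opf_op_indicE k B w : measurable B ->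
  (opf_op k \1_B w)%:E = opf_weighted M y u zeta k w B.
Proof.
move=> mB; rewrite opf_op_indic//; symmetry.
exact: (prob_fineK (opf_weighted_setT k) w mB).
Qed.

Lemma u_past_single k E B n : (k <= K)%N -> opf_past u zeta k k E -> measurable B ->
  fine (P (E `&` u k n @^-1` B)) = \int[P]_(w in E) opf_op k \1_B w.
Proof.
move=> kK FE mB; rewrite (iid_given_single (opf_weighted_setT k) (opf_iid kK))//.
by rewrite /Rintegral; congr fine; apply: eq_integral => w _; rewrite opf_op_indicE.
Qed.

Lemma u_past_pair k E B B' n m : (k <= K)%N -> n != m -> opf_past u zeta k k E ->
  measurable B -> measurable B' ->
  fine (P (E `&` (u k n @^-1` B `&` u k m @^-1` B'))) =
  \int[P]_(w in E) (opf_op k \1_B w * opf_op k \1_B' w).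
Proof.
move=> kK nm FE mB mB'; rewrite (iid_given_pair (opf_weighted_setT k) (opf_iid kK))//.
rewrite /Rintegral; congr fine; apply: eq_integral => w _.
by rewrite EFinM !opf_op_indicE.
Qed.

Lemma gC_setT (w : Om) : gC setT = 1%E. Proof. exact: probability_setT. Qed.

Lemma fine_cst_prob (E : set Om) (r : \bar R) : measurable E ->
  (r \is a fin_num) -> fine (\int[P]_(w in E) r)%E = fine (P E) * fine r.
Proof.
by move=> mE rf; rewrite integral_cst// mulrC fineM//; exact: fin_num_measure.
Qed.

Lemma zeta_past_single k E B n : (k < K)%N -> opf_past u zeta k.+1 k E ->
  measurable B -> fine (P (E `&` zeta k n @^-1` B)) = fine (P E) * fine (gC B).
Proof.
move=> kK FE mB; rewrite (iid_given_single gC_setT (opf_noise_gC kK))//.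
rewrite fine_cst_prob//; last exact: fin_num_measure.
exact: (sub_g_sigma_algebra (@opf_gen_measurable _ _) FE).
Qed.

Lemma zeta_past_pair k E B B' n m : (k < K)%N -> n != m ->
  opf_past u zeta k.+1 k E -> measurable B -> measurable B' ->
  fine (P (E `&` (zeta k n @^-1` B `&` zeta k m @^-1` B'))) =
  fine (P E) * (fine (gC B) * fine (gC B')).
Proof.
move=> kK nm FE mB mB'; rewrite (iid_given_pair gC_setT (opf_noise_gC kK))//.
rewrite fine_cst_prob ?fineM//; try exact: fin_num_measure.
  exact: (sub_g_sigma_algebra (@opf_gen_measurable _ _) FE).
by rewrite fin_numM//; exact: fin_num_measure.
Qed.

Lemma Rintegral_indic2 (E E' : set Om) : measurable E -> measurable E' ->
  \int[P]_w (\1_E w * \1_E' w) = fine (P (E `&` E')).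
Proof.
move=> mE mE'; rewrite -Rintegral_indic; last exact: measurableI.
by apply: eq_Rintegral => w _; rewrite indicI.
Qed.

Let mu_ k n B : measurable B -> measurable (u k n @^-1` B).
Proof. by move=> mB; rewrite -[X in measurable X]setTI; exact: measurable_funPT. Qed.

Let mzeta k n B : measurable B -> measurable (zeta k n @^-1` B).
Proof. by move=> mB; rewrite -[X in measurable X]setTI; exact: measurable_funPT. Qed.

Lemma resampling_error k phi : (k <= K)%N -> bfun phi -> (forall x, `|phi x| <= 1) ->
  \int[P]_w ((N%:R^-1 * \sum_(n < N) phi (u k n w) - opf_op k phi w) ^+ 2) <= N%:R^-1.
Proof.
move=> kK bphi phi1.
apply: (monte_carlo (@opf_gen_measurable k k) (Z := fun n => u k n) _
  (markov_opf_op k) (G := measurable)) => //.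
- by rewrite sigma_algebra_id//; exact: sigma_algebra_measurable.
- exact: measurableI.
- move=> n E B FE mB.
  have mE := sub_g_sigma_algebra (@opf_gen_measurable k k) FE.
  transitivity (fine (P (E `&` u k n @^-1` B))).
    by rewrite -Rintegral_indic2//; exact: mu_.
  rewrite u_past_single//.
  exact: esym (Rintegral_indic_mul P E (opf_op k \1_B : Om -> R)).
- move=> n m B B' nm mB mB'.
  have := u_past_pair kK nm (@opf_past_setT k k) mB mB'.
  by rewrite setTI => <-; rewrite -Rintegral_indic2//; exact: mu_.
Qed.

(* The pairs (u_k^n, zeta_k^n) are i.i.d. given the past before resampling, so
   resampling and mutation together cost a single N^-1/2. *)
Lemma proposal_error k (phi : 'cV[R]_p * 'cV[R]_p -> R) : (k < K)%N ->
  bfun phi -> (forall x, `|phi x| <= 1) ->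
  \int[P]_w ((N%:R^-1 * \sum_(n < N) phi (u k n w, zeta k n w) -
    opf_op k (fun v => \int[gC]_z phi (v, z)) w) ^+ 2) <= N%:R^-1.
Proof.
move=> kK bphi phi1.
pose G : set (set ('cV[R]_p * 'cV[R]_p)) := [set A `*` B | A in measurable & B in measurable].
have AE A B w : measurable A -> measurable B ->
    opf_op k (fun v => \int[gC]_z \1_(A `*` B) (v, z)) w =
    opf_op k \1_A w * fine (gC B).
  move=> mA mB.
  have -> : (fun v => \int[gC]_z \1_(A `*` B) (v, z)) = fun v => fine (gC B) * \1_A v.
    apply/funext => v; rewrite mulrC -Rintegral_indic//.
    rewrite -(bfun_RintegralZ (probability_ltoo gC)); last exact: bfun_indic.
    by apply: eq_Rintegral => z _; rewrite !indicE in_setX/= -natrM mulnb.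
  have woo : (opf_weighted M y u zeta k w setT < +oo)%E.
    by rewrite opf_weighted_setT ltry.
  exact: etrans (bfun_RintegralZ woo _ (bfun_indic mA)) (mulrC _ _).
have bA A : measurable A -> @bfun _ Om R (opf_op k \1_A).
  move=> mA; exact: (bfun_comp
    (measurable_id_g_sigma_algebra (@opf_gen_measurable k k))
    (markov_bfun (markov_opf_op k) (bfun_indic mA))).
pose A2 (f : 'cV[R]_p * 'cV[R]_p -> R) := opf_op k (fun v => \int[gC]_z f (v, z)).
have mA2 : markov_op A2 := markov_comp (markov_opf_op k) (markov_slice _ gC).
rewrite -[opf_op k _]/(A2 phi).
apply: (monte_carlo (@opf_gen_measurable k k)
  (Z := fun n w => (u k n w, zeta k n w)) _ mA2 (G := G)) => //.
- by move=> n; apply/measurable_fun_pairP; split; exact: measurable_funPT.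
- exact: measurable_prod_measurableType.
- move=> _ _ [A mA [B mB <-]] [A' mA' [B' mB' <-]].
  exists (A `&` A'); first exact: measurableI.
  exists (B `&` B'); first exact: measurableI.
  by rewrite setXI.
- by exists setT => //; exists setT => //; rewrite setXTT.
- move=> n E _ FE [A mA [B mB <-]].
  have mE := sub_g_sigma_algebra (@opf_gen_measurable k k) FE.
  (* The noise [zeta k] is independent even of the past enlarged by [u k], so the event on [u k n]
     is absorbed into the conditioning event. *)
  have uE : opf_past u zeta k.+1 k (E `&` u k n @^-1` A).
    apply: (@measurableI _ (g_sigma_algebraType (opf_gen k.+1 k))).
      by apply: sub_smallest2r FE => //; exact: opf_genS.
    by rewrite -[X in measurable X]setTI; exact: measurable_u_past.
  transitivity (fine (P (E `&` u k n @^-1` A `&` zeta k n @^-1` B))).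
    rewrite -setIA -Rintegral_indic2//.
    by apply: measurableI; [exact: mu_|exact: mzeta].
  rewrite zeta_past_single// u_past_single//; last exact: ltnW.
  rewrite -Rintegral_indic_mul -RintegralZr//; last first.
    by apply: (bfun_integrable Poo); apply: bfunM; [exact: bfun_indic|exact: bA].
  apply: eq_Rintegral => w _; rewrite -mulrA; congr (_ * _).
  exact: esym (AE _ _ _ mA mB).
- move=> n m _ _ nm [A mA [B mB <-]] [A' mA' [B' mB' <-]].
  have uE : opf_past u zeta k.+1 k (u k n @^-1` A `&` u k m @^-1` A').
    apply: (@measurableI _ (g_sigma_algebraType (opf_gen k.+1 k)));
      by rewrite -[X in measurable X]setTI; exact: measurable_u_past.
  transitivity (fine (P ((u k n @^-1` A `&` u k m @^-1` A') `&`
      (zeta k n @^-1` B `&` zeta k m @^-1` B')))).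
    rewrite setIACA -Rintegral_indic2//.
      by apply: measurableI; [exact: mu_|exact: mzeta].
    by apply: measurableI; [exact: mu_|exact: mzeta].
  rewrite zeta_past_pair//.
  have := u_past_pair (ltnW kK) nm (@opf_past_setT k k) mA mA'.
  rewrite setTI => ->.
  rewrite -RintegralZr//; last first.
    by apply: (bfun_integrable Poo); apply: bfunM; exact: bA.
  apply: eq_Rintegral => w _; rewrite mulrACA; congr (_ * _).
    exact: esym (AE _ _ _ mA mB).
  exact: esym (AE _ _ _ mA' mB').
Qed.

Definition propagate k (f : 'cV[R]_p -> R) (v : 'cV[R]_p) : R :=
  \int[gC]_z f (wprop k v + z).

(** The distance of the weighted measure to [pi] is at most [e], in squared form; [pi] is a mere
    functional, so that a quotient of expectations can be used directly. *)
Definition l2err k (pi : ('cV[R]_p -> R) -> R) (e : R) := forall phi : 'cV[R]_p -> R,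
  bfun phi -> (forall x, `|phi x| <= 1) ->
  \int[P]_w ((opf_op k phi w - pi phi) ^+ 2) <= e ^+ 2.

Let s : R := (Num.sqrt N%:R)^-1.

Let s_ge0 : 0 <= s. Proof. by rewrite invr_ge0 sqrtr_ge0. Qed.

Let s_sqr : s ^+ 2 = N%:R^-1.
Proof. by rewrite exprVn sqr_sqrtr. Qed.

Lemma bfun_opf_op k (phi : 'cV[R]_p -> R) : bfun phi -> @bfun _ Om R (opf_op k phi).
Proof.
move=> bphi; exact: (bfun_comp
  (measurable_id_g_sigma_algebra (@opf_gen_measurable k k))
  (markov_bfun (markov_opf_op k) bphi)).
Qed.

Lemma bfun_particles k (phi : 'cV[R]_p * 'cV[R]_p -> R) : bfun phi ->
  bfun (fun w => N%:R^-1 * \sum_(n < N) phi (u k n w, zeta k n w)).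
Proof.
move=> bphi; apply: bfunZ; apply: bfun_sum => n.
have mz : measurable_fun setT (fun w => (u k n w, zeta k n w)).
  by apply/measurable_fun_pairP; split; exact: measurable_funPT.
exact: (bfun_comp mz).
Qed.

(** Minkowski: the sampling error [s] of the pairs, plus the inherited error [e] at [phi'], which is
    still bounded by 1 after averaging over the noise. *)
Lemma l2err_particles k pi e (phi : 'cV[R]_p * 'cV[R]_p -> R) (phi' : 'cV[R]_p -> R) :
  (k < K)%N -> 0 <= e -> l2err k pi e -> bfun phi -> (forall x, `|phi x| <= 1) ->
  (forall v, phi' v = \int[gC]_z phi (v, z)) ->
  \int[P]_w ((N%:R^-1 * \sum_(n < N) phi (u k n w, zeta k n w) - pi phi') ^+ 2) <=
  (s + e) ^+ 2.
Proof.
move=> kK e0 err bphi phi1 /funext phi'E.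
have ms : markov_op (fun (f : 'cV[R]_p * 'cV[R]_p -> R) v => \int[gC]_z f (v, z)) :=
  markov_slice _ gC.
have bphi' : bfun phi' by rewrite phi'E; exact: (markov_bfun ms).
have phi'1 x : `|phi' x| <= 1 by rewrite phi'E; exact: (markov_bound ms).
have -> : \int[P]_w ((N%:R^-1 * \sum_(n < N) phi (u k n w, zeta k n w) - pi phi') ^+ 2) =
    \int[P]_w ((N%:R^-1 * \sum_(n < N) phi (u k n w, zeta k n w) - opf_op k phi' w +
      (opf_op k phi' w - pi phi')) ^+ 2).
  by apply: eq_Rintegral => w _; rewrite addrA subrK.
apply: bfun_minkowski => //.
- by apply: bfunB; [exact: bfun_particles|exact: bfun_opf_op].
- by apply: bfunB; [exact: bfun_opf_op|exact: bfun_cst].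
- by rewrite s_sqr phi'E; exact: proposal_error.
- exact: err.
Qed.

(** Numerator and normalizer are each off by at most [s + e], and both errors are divided by the
    limit normalizer, which is at least [kap]; the factor 2 counts the two. No lower bound on the
    empirical weights enters. *)
Lemma l2err_step k pi pi' e kap : (k < K)%N -> 0 <= e -> 0 < kap ->
  l2err k pi e -> kap <= pi (ws k) ->
  (forall f, bfun f -> pi' f = pi (fun v => ws k v * propagate k f v) / pi (ws k)) ->
  l2err k.+1 pi' (2 * kap^-1 * (e + s)).
Proof.
move=> kK e0 kap0 err kapb pi'E f bf f1; rewrite pi'E//.
set al := pi (fun _ => _ * _); set be := pi (ws k).
have be0 : 0 < be by exact: lt_le_trans kapb.
(* Weight times test function at the proposed point, as a function of the pair (particle, noise);
   its sample mean is the numerator [a] of the update. *)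
pose F (x : 'cV[R]_p * 'cV[R]_p) := ws k x.1 * f (wprop k x.1 + x.2).
have bws1 : bfun (fun x : 'cV[R]_p * 'cV[R]_p => ws k x.1).
  exact: (bfun_comp measurable_fst (bfun_ws k)).
have bfw : bfun (fun x : 'cV[R]_p * 'cV[R]_p => f (wprop k x.1 + x.2)).
  have mw : measurable_fun setT (fun x : 'cV[R]_p * 'cV[R]_p => wprop k x.1 + x.2).
    apply: measurable_addmx; last exact: measurable_snd.
    exact: (measurableT_comp (measurable_wprop k) measurable_fst).
  exact: (bfun_comp mw).
have bF : bfun F by exact: bfunM.
have F1 x : `|F x| <= 1 by rewrite normrM mulr_ile1// ws_le1.
pose a w := N%:R^-1 * \sum_(n < N) F (u k n w, zeta k n w).
pose b w := N%:R^-1 * \sum_(n < N) ws k (u k n w).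
have ha : \int[P]_w ((a w - al) ^+ 2) <= (s + e) ^+ 2.
  apply: (l2err_particles kK e0 err bF F1) => v.
  rewrite /F /propagate/= (bfun_RintegralZ (probability_ltoo gC))//.
  have mv : measurable_fun setT (fun z : 'cV[R]_p => (v, z)).
    by apply/measurable_fun_pairP; split; [exact: measurable_cst|exact: measurable_id].
  exact: (bfun_comp mv bfw).
have hb : \int[P]_w ((b w - be) ^+ 2) <= (s + e) ^+ 2.
  apply: (l2err_particles kK e0 err bws1 (fun x => ws_le1 k x.1)) => v.
  rewrite /= Rintegral_cst// [X in _ * X](_ : _ = 1) ?mulr1//.
  exact: (congr1 fine (probability_setT gC)).
have ba : bfun a by exact: bfun_particles.
have bb : bfun b by exact: (bfun_particles k bws1).
(* The error is [a / b - al / be = ((a - al) + r * (be - b)) / be] with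
   [r = a / b] bounded by 1. *)
pose r (w : Om) := opf_op k.+1 f w.
have br : @bfun _ Om R r by exact: bfun_opf_op.
have r1 (w : Om) : `|r w| <= 1 by exact: (markov_bound (markov_opf_op k.+1)).
have rb (w : Om) : r w * b w = a w.
  rewrite /r /b /a opf_opS// mulrCA; congr (_ * _).
  rewrite mulr_suml; apply: eq_bigr => n _ /=.
  have S0 : \sum_(m < N) ws k (u k m w) != 0.
    by rewrite gt_eqF// (@sum_ws_gt0 k (fun m => u k m w)).
  by rewrite /F/= mulrAC divfK.
have kb : be^-1 * (s + e) <= kap^-1 * (s + e).
  by rewrite ler_wpM2r ?addr_ge0// lef_pV2.
have -> : 2 * kap^-1 * (e + s) = kap^-1 * (s + e) + kap^-1 * (s + e) by ring.
have bnd g : bfun g -> \int[P]_w (g w ^+ 2) <= (s + e) ^+ 2 ->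
    \int[P]_w ((be^-1 * g w) ^+ 2) <= (kap^-1 * (s + e)) ^+ 2.
  move=> bg hg; under eq_Rintegral do rewrite exprMn.
  rewrite (bfun_RintegralZ Poo); last exact: bfunM.
  apply: (@le_trans _ _ (be^-1 ^+ 2 * (s + e) ^+ 2)).
    by rewrite ler_wpM2l// sqr_ge0.
  rewrite -exprMn ler_pXn2r// ?nnegrE.
    by rewrite mulr_ge0 ?addr_ge0// invr_ge0 ltW.
  by rewrite mulr_ge0 ?addr_ge0// invr_ge0 ltW.
have := bfun_minkowski (P := P) (f := fun w => be^-1 * (a w - al))
  (g := fun w => be^-1 * (r w * (be - b w)))
  (a := kap^-1 * (s + e)) (b := kap^-1 * (s + e)).
have -> : \int[P]_x ((be^-1 * (a x - al) + be^-1 * (r x * (be - b x))) ^+ 2) =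
    \int[P]_w ((opf_op k.+1 f w - al / be) ^+ 2).
  apply: eq_Rintegral => w _; congr (_ ^+ 2); rewrite -(rb w) -/(r w).
  by field; rewrite gt_eqF.
have bal : bfun (fun w => a w - al) := bfunB ba (bfun_cst al).
have bbe : bfun (fun w => be - b w) := bfunB (bfun_cst be) bb.
have brb : bfun (fun w : Om => r w * (be - b w)) := bfunM br bbe.
apply.
- exact: bfunZ.
- exact: bfunZ.
- by rewrite mulr_ge0 ?addr_ge0// invr_ge0 ltW.
- by rewrite mulr_ge0 ?addr_ge0// invr_ge0 ltW.
- exact: bnd.
- apply: bnd => //; apply: le_trans hb.
  apply: (bfun_le_Rintegral Poo); [exact: bfunM| |].
    by have bb' := bfunB bb (bfun_cst be); exact: bfunM.
  move=> w; rewrite exprMn -(sqrrN (b w - be)) opprB ler_piMl ?sqr_ge0//.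
  by rewrite -real_normK ?num_real// expr_le1.
Qed.

Lemma l2err_resampled k pi e (phi : 'cV[R]_p -> R) : (k <= K)%N -> 0 <= e ->
  l2err k pi e -> bfun phi -> (forall x, `|phi x| <= 1) ->
  \int[P]_w ((\int[opf_resampled u k w]_x phi x - pi phi) ^+ 2) <= (s + e) ^+ 2.
Proof.
move=> kK e0 err bphi phi1.
have bu : bfun (fun w => N%:R^-1 * \sum_(n < N) phi (u k n w)).
  apply: bfunZ; apply: bfun_sum => n.
  exact: (bfun_comp (@measurable_funPT _ _ _ _ (u k n))).
have := bfun_minkowski (P := P)
  (f := fun w => N%:R^-1 * \sum_(n < N) phi (u k n w) - opf_op k phi w)
  (g := fun w => opf_op k phi w - pi phi) (a := s) (b := e).
have -> : \int[P]_x ((N%:R^-1 * \sum_(n < N) phi (u k n x) - opf_op k phi x +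
      (opf_op k phi x - pi phi)) ^+ 2) =
    \int[P]_w ((\int[opf_resampled u k w]_x phi x - pi phi) ^+ 2).
  apply: eq_Rintegral => w _; rewrite addrA subrK [X in _ = (X - _) ^+ 2]Rintegral_wdirac//.
  by rewrite mulr_sumr.
apply => //.
- by apply: bfunB => //; exact: bfun_opf_op.
- by apply: bfunB; [exact: bfun_opf_op|exact: bfun_cst].
- by rewrite s_sqr; exact: resampling_error.
- exact: err.
Qed.

End particle_filter.

(** * Identification of the filtering distribution *)

Section independence.
Context {d} {Om : measurableType d} {R : realType} (P : probability Om R).
Context {I : eqType} (F : I -> set (set Om)).
Hypothesis Fm : forall i, F i `<=` measurable.
Hypothesis FI : forall i, setI_closed (F i).
Hypothesis FT : forall i, F i setT.
Hypothesis indF : mutually_independent P F.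

Let Poo := probability_ltoo P.

(** A pi-system for the sigma-algebra generated by the sources in [J], made of events to which the
    product formula of mutual independence applies. *)
Definition cylinders (J : pred I) : set (set Om) :=
  [set A | exists s (E : I -> set Om), [/\ uniq s, {subset s <= J},
    forall i, F i (E i) & A = \bigcap_(i in [set` s]) E i]].

Lemma cylinders_measurable J : cylinders J `<=` measurable.
Proof.
move=> _ [s [E [_ _ FE ->]]]; elim: s => [|i s IH].
  rewrite (_ : \bigcap_(i in _) _ = setT)//.
  by apply/seteqP; split => // w _ i.
rewrite (_ : \bigcap_(j in _) _ = E i `&` \bigcap_(j in [set` s]) E j).
  by apply: measurableI => //; exact: Fm.
apply/seteqP; split => w /=.
  move=> h; split; first by apply: h; rewrite /= mem_head.
  by move=> j /= js; apply: h; rewrite /= inE js orbT.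
by move=> [h1 h2] j /=; rewrite inE => /orP[/eqP ->//|js]; exact: h2.
Qed.

Lemma cylindersI J : setI_closed (cylinders J).
Proof.
move=> _ _ [s [E [us sJ FE ->]]] [s' [E' [us' sJ' FE' ->]]].
pose D i := (if i \in s then E i else setT) `&` (if i \in s' then E' i else setT).
exists (undup (s ++ s')), D; split.
- exact: undup_uniq.
- by move=> i; rewrite mem_undup mem_cat => /orP[/sJ|/sJ'].
- by move=> i; apply: FI; case: ifP => // _; exact: FT.
- apply/seteqP; split => w /=.
    move=> [h h'] i /=; rewrite mem_undup mem_cat => _; split.
      by case: ifP => // si; exact: h.
    by case: ifP => // si; exact: h'.
  move=> h; split => i /= si.
    by have [] := h i; rewrite /= ?mem_undup ?mem_cat ?si.
  by have [] := h i; rewrite /= ?mem_undup ?mem_cat ?si ?orbT//.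
Qed.

Lemma cylindersT J : cylinders J setT.
Proof.
exists [::], (fun=> setT); split => //; apply/seteqP; split => // w _ i //.
Qed.

Lemma cylinders_single J i E : i \in J -> F i E -> <<s cylinders J>> E.
Proof.
move=> iJ FE; apply: sub_sigma_algebra.
exists [:: i], (fun j => if j == i then E else setT); split => //.
- by move=> j; rewrite inE => /eqP ->.
- by move=> j; case: eqP => [->|].
- apply/seteqP; split => w /=; first by move=> Ew j /=; rewrite inE => ->.
  by move=> /(_ i); rewrite /= inE eqxx; exact.
Qed.

Context {d'} {T : measurableType d'} (Z : {RV P >-> T}).

(** A source [j] outside [J] may be integrated out with the rest frozen. On rectangles this is
    independence of [Z] from cylinders; two monotone class arguments extend it. *)
Lemma indep_integral (J : pred I) j (h : g_sigma_algebraType (cylinders J) * T -> R) :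
  j \notin J -> F j = preimage_set_system setT Z measurable -> bfun h ->
  \int[P]_w h (w, Z w) = \int[P]_w \int[distribution P Z]_z h (w, z).
Proof.
move=> jJ FjE.
have mid := measurable_id_g_sigma_algebra (@cylinders_measurable J).
have mZ : measurable_fun setT (Z : Om -> T) by exact: measurable_funPT.
have mpair : measurable_fun setT
    (fun w : Om => (w, Z w) : g_sigma_algebraType (cylinders J) * T).
  by apply/measurable_fun_pairP.
have dF := daniell_pull (daniell_Rintegral Poo) mid.
move: h; apply: mclass_prod.
  apply: mclass_eq.
    exact: (daniell_pull (daniell_Rintegral Poo) mpair).
  exact: (daniell_markov dF (markov_slice _ (distribution P Z))).
move=> A B mA mB /=.
have mB' : measurable (Z @^-1` B) by rewrite -[X in measurable X]setTI; exact: mZ.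
have bB : bfun (\1_(Z @^-1` B) : Om -> R) by exact: bfun_indic.
have -> : \int[P]_w \int[distribution P Z]_z (\1_A w * \1_B z) =
    \int[P]_w (fine (P (Z @^-1` B)) * \1_A w).
  apply: eq_Rintegral => w _.
  rewrite (bfun_RintegralZ (probability_ltoo _)); last exact: bfun_indic.
  by rewrite Rintegral_indic// mulrC.
transitivity (\int[P]_w (\1_A w * \1_(Z @^-1` B) w)); first by [].
move: A mA.
suff H (f : g_sigma_algebraType (cylinders J) -> R) : bfun f ->
    \int[P]_w (f w * \1_(Z @^-1` B) w) = fine (P (Z @^-1` B)) * \int[P]_w f w.
  move=> A mA; rewrite (H _ (bfun_indic mA)) (bfun_RintegralZ Poo)//.
  exact: (bfun_comp mid (bfun_indic mA)).
move: f; refine (@mclass_pi _ (g_sigma_algebraType (cylinders J)) R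
  (fun f => \int[P]_w (f w * \1_(Z @^-1` B) w) = fine (P (Z @^-1` B)) * \int[P]_w f w)
  (cylinders J) _ _ _ _ _); last first.
- move=> A CA; have mA := cylinders_measurable CA.
  rewrite [in RHS]Rintegral_indic//.
  transitivity (\int[P]_w \1_(A `&` Z @^-1` B) w).
    by apply: eq_Rintegral => w _; rewrite indicI.
  rewrite Rintegral_indic; last exact: measurableI.
  case: CA => s [E [us sJ FE AE]].
  (* The event on [Z] joins the cylinder as one more coordinate, which is free because [j] does not
     occur in [s]. *)
  pose E' i := if i == j then Z @^-1` B else E i.
  have js : j \notin s by apply: contra jJ => /sJ.
  have E's i : i \in s -> E' i = E i.
    by move=> si; rewrite /E'; case: eqP => // ij; rewrite -ij si in js.
  have := indF (s := j :: s) (E := E').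
  rewrite /= js us => /(_ isT) h.
  have E'F i : i \in j :: s -> F i (E' i).
    move=> _; rewrite /E'; case: eqP => [->|//]; rewrite FjE.
    by exists B => //; rewrite setTI.
  have sF i : i \in s -> F i (E i) by move=> _; exact: FE.
  have -> : A `&` Z @^-1` B = \bigcap_(i in [set` j :: s]) E' i.
    rewrite AE; apply/seteqP; split => w /=.
      move=> [h1 h2] i /=; rewrite inE => /orP[/eqP ->|si].
        by rewrite /E' eqxx.
      by rewrite E's//; exact: h1.
    move=> h1; split.
      by move=> i /= si; rewrite -E's//; apply: h1; rewrite /= inE si orbT.
    by have := h1 j; rewrite /= mem_head /E' eqxx; exact.
  have EbigE : P A = \big[mule/1%E]_(i <- s) P (E' i).
    by rewrite AE (indF us sF); apply: eq_big_seq => i /E's ->.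
  rewrite h// big_cons {1}/E' eqxx fineM; last 2 first.
  - exact: fin_num_measure.
  - by rewrite -EbigE; exact: fin_num_measure.
  by rewrite -EbigE.
- exact: cylindersT.
- exact: cylindersI.
- by [].
- apply: mclass_eq; last exact: (daniellZ _ dF).
  exact: (daniell_pull (daniell_mul (daniell_Rintegral Poo) bB) mid).
Qed.

End independence.

(** * Likelihood of the signal path, and conditioning on small boxes *)

Section signal_process.
Context {R : realType} {p q : nat} (M : model R p q).
Context {d} {Om : measurableType d} (P : probability Om R).
Variables (U xi : nat -> {RV P >-> 'cV[R]_p}) (Y eta : nat -> {RV P >-> 'cV[R]_q}).
Hypothesis sigP : signal M U xi Y eta.
Variable y : nat -> 'cV[R]_q.
Local Notation H := (obsop M).

Let Poo := probability_ltoo P.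

Let FN := noise_events (U 0) (fun k => xi k) (fun k => eta k).

Let FNm i : FN i `<=` measurable.
Proof.
by case: i => [[u|k]|k] E [B mB <-]; rewrite /=; exact: measurable_funPT.
Qed.

Let FNI i : setI_closed (FN i).
Proof.
have gen (T : measurableType (measure_mx_display default_measure_display))
    (X : Om -> T) : setI_closed (preimage_set_system setT X measurable).
  move=> _ _ [B mB <-] [B' mB' <-]; exists (B `&` B'); first exact: measurableI.
  by rewrite !setTI preimage_setI.
by case: i => [[u|k]|k]; exact: gen.
Qed.

Let FNT i : FN i setT.
Proof. by case: i => [[u|k]|k]; exists setT => //; rewrite setTI preimage_setT. Qed.

(** As [inr j] stands for [eta j.+1], these are the sources of [U_0, ..., U_k] together with
    [eta_1, ..., eta_l]. *)
Definition noise_past k l (i : unit + nat + nat) : bool :=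
  match i with inl (inl _) => true | inl (inr j) => (j < k)%N | inr j => (j < l)%N end.

Local Notation past k l := (g_sigma_algebraType (cylinders FN (noise_past k l))).

Lemma measurable_past_U k l j : (j <= k)%N -> measurable_fun setT (U j : past k l -> _).
Proof.
elim: j => [_|j IH jk].
  move=> _ B mB; rewrite setTI; apply: (cylinders_single FNT (i := inl (inl tt))) => //.
  by exists B => //; rewrite setTI.
rewrite (_ : (U j.+1 : past k l -> _) = fun w => psi M (U j w) + xi j w); last first.
  by apply/funext => w; exact: (signal_step sigP).
apply: measurable_addmx.
  exact: (measurableT_comp (psi_meas M) (IH (ltnW jk))).
move=> _ B mB; rewrite setTI; apply: (cylinders_single FNT (i := inl (inr j))) => //.
by exists B => //; rewrite setTI.
Qed.

Lemma measurable_past_Y k l j : (j < k)%N -> (j < l)%N ->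
  measurable_fun setT (Y j.+1 : past k l -> _).
Proof.
move=> jk jl.
rewrite (_ : (Y j.+1 : past k l -> _) = fun w => H *m U j.+1 w + eta j.+1 w); last first.
  by apply/funext => w; exact: (signal_obs sigP).
apply: measurable_addmx; first by apply: measurable_mulmx; exact: measurable_past_U.
move=> _ B mB; rewrite setTI; apply: (cylinders_single FNT (i := inr j)) => //.
by exists B => //; rewrite setTI.
Qed.

Definition lik k (w : Om) : R :=
  \prod_(0 <= j < k) gauss_pdf (Gamma M) (y j.+1 - H *m U j.+1 w).

Lemma likS k w :
  lik k.+1 w = lik k w * gauss_pdf (Gamma M) (y k.+1 - H *m U k.+1 w).
Proof. by rewrite /lik big_nat_recr. Qed.

(* Kallianpur-Striebel: [y] is a fixed vector here, not the observation process;
   the filter at [y] is the normalization of this functional. *)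
Definition ufilter k (f : 'cV[R]_p -> R) : R := \int[P]_w (f (U k w) * lik k w).

Lemma bfun_past_pdf k l j : (j < k)%N ->
  bfun (fun w : past k l => gauss_pdf (Gamma M) (y j.+1 - H *m U j.+1 w)).
Proof.
move=> jk; have mr : measurable_fun setT (fun w : past k l => y j.+1 - H *m U j.+1 w).
  apply: measurable_addmx; first exact: measurable_cst.
  under eq_fun do rewrite -mulNmx.
  by apply: measurable_mulmx; exact: measurable_past_U.
exact: (bfun_comp mr (bfun_gauss_pdf (posdef_Gamma M))).
Qed.

Lemma bfun_prod_nat d1 (T : measurableType d1) (F : nat -> T -> R) m n :
  (forall j, (m <= j < n)%N -> bfun (F j)) ->
  bfun (fun x => \prod_(m <= j < n) F j x).
Proof.
move=> bF; pose G j := if (m <= j < n)%N then F j else fun=> 1.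
rewrite (_ : (fun _ => _) = fun x => \prod_(m <= j < n) G j x).
  apply: bfun_prod => j; rewrite /G; case: ifP => h; last exact: bfun_cst.
  exact: bF.
by apply/funext => x; apply: eq_big_nat => j h; rewrite /G h.
Qed.

Lemma bfun_past_lik k l : bfun (lik k : past k l -> R).
Proof. by apply: bfun_prod_nat => j /andP[_ jk]; exact: bfun_past_pdf. Qed.

Let mid k l := measurable_id_g_sigma_algebra
  (@cylinders_measurable _ _ _ FN FNm (noise_past k l)).

Lemma bfun_lik k : bfun (lik k).
Proof. exact: (bfun_comp (@mid k k) (bfun_past_lik k k)). Qed.

Definition lawG k : probability 'cV[R]_q R := distribution P (eta k.+1).

Lemma lawGE k B : measurable B -> lawG k B = gauss (Gamma M) B.
Proof. exact: (signal_eta sigP). Qed.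

Lemma lawSE k B : measurable B -> distribution P (xi k) B = gauss (Sigma M) B.
Proof. exact: (signal_xi sigP). Qed.

Variable gC : probability 'cV[R]_p R.
Hypothesis gCE : forall B, measurable B -> gC B = gauss (Cmx M) B.

Lemma ufilter0 f : bfun f -> ufilter 0 f = \int[mu0 M]_x f x.
Proof.
have mU : measurable_fun setT (U 0 : Om -> _) by exact: measurable_funPT.
move: f; apply: mclass_measurable.
  apply: mclass_eq; last exact: (daniell_Rintegral (probability_ltoo _)).
  exact: (daniell_pull (daniell_mul (daniell_Rintegral Poo) (bfun_lik 0)) mU).
move=> A mA; rewrite Rintegral_indic// /ufilter.
under eq_Rintegral do rewrite /lik big_geq// mulr1.
have mUA : measurable (U 0 @^-1` A) by rewrite -[X in measurable X]setTI; exact: mU.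
rewrite (_ : \int[P]_w _ = \int[P]_w \1_(U 0 @^-1` A) w)// Rintegral_indic//.
by congr fine; exact: (signal_init sigP).
Qed.

(** [xi k] is independent of the sources of [U k] and [lik k]; integrating it out of the transition
    and the last likelihood factor is [gauss_update]. *)
Lemma ufilterS k f : bfun f -> ufilter k.+1 f = update_cst M *
  ufilter k (fun v => ws M y k v * \int[gC]_z f (wprop M y k v + z)).
Proof.
move=> bf.
pose h (x : past k 0 * 'cV[R]_p) : R :=
  lik k x.1 * (f (psi M (U k x.1) + x.2) *
    gauss_pdf (Gamma M) (y k.+1 - H *m (psi M (U k x.1) + x.2))).
have mUx : measurable_fun setT (fun x : past k 0 * 'cV[R]_p => psi M (U k x.1) + x.2).
  apply: measurable_addmx; last exact: measurable_snd.
  apply: (measurableT_comp (psi_meas M)).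
  by apply: (measurableT_comp _ measurable_fst); exact: measurable_past_U.
have bh : bfun h.
  apply: bfunM; first exact: (bfun_comp measurable_fst (bfun_past_lik k 0)).
  apply: bfunM; first exact: (bfun_comp mUx).
  have mr : measurable_fun setT (fun x : past k 0 * 'cV[R]_p =>
      y k.+1 - H *m (psi M (U k x.1) + x.2)).
    apply: measurable_addmx; first exact: measurable_cst.
    under eq_fun do rewrite -mulNmx.
    exact: measurable_mulmx.
  exact: (bfun_comp mr (bfun_gauss_pdf (posdef_Gamma M))).
transitivity (\int[P]_w h (w, xi k w)).
  apply: eq_Rintegral => w _; rewrite likS (signal_step sigP).
  exact: mulrCA.
rewrite (indep_integral FNm FNI FNT (signal_indep sigP) (j := inl (inr k)) _ _ bh)//; last first.
  by rewrite unfold_in/= ltnn.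
have mwp : markov_op (fun (g : 'cV[R]_p -> R) v => \int[gC]_z g (wprop M y k v + z)).
  have mw : measurable_fun setT (fun x : 'cV[R]_p * 'cV[R]_p => wprop M y k x.1 + x.2).
    apply: measurable_addmx; last exact: measurable_snd.
    exact: (measurableT_comp (measurable_wprop M y k) measurable_fst).
  have ms : markov_op (fun (g : 'cV[R]_p -> R) x => g (wprop M y k x.1 + x.2)).
    split=> [g|g c bg gc x|x]; [exact: (bfun_comp mw)|exact: gc|exact: daniell_eval].
  exact: (markov_comp (markov_slice _ gC) ms).
have mU : measurable_fun setT (U k : Om -> _) by exact: measurable_funPT.
have bw := bfun_comp mU (bfunM (bfun_ws M y k) (markov_bfun mwp bf)).
rewrite /ufilter -(bfun_RintegralZ Poo); last exact: (bfunM bw (bfun_lik k)).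
apply: eq_Rintegral => w _.
have e := gauss_update (lawSE k) gCE (psi M (U k w)) (y k.+1) bf.
transitivity (lik k w * \int[distribution P (xi k)]_x (f (psi M (U k w) + x) *
    gauss_pdf (Gamma M) (y k.+1 - H *m (psi M (U k w) + x)))).
  have ma : measurable_fun setT (fun x : 'cV[R]_p => psi M (U k w) + x).
    by apply: measurable_addmx; [exact: measurable_cst|exact: measurable_id].
  have mr : measurable_fun setT (fun x : 'cV[R]_p => y k.+1 - H *m x).
    apply: measurable_addmx; first exact: measurable_cst.
    by under eq_fun do rewrite -mulNmx; apply: measurable_mulmx; exact: measurable_id.
  have bin := bfunM (bfun_comp ma bf)
    (bfun_comp (measurableT_comp mr ma) (bfun_gauss_pdf (posdef_Gamma M))).
  exact: (bfun_RintegralZ (probability_ltoo (distribution P (xi k))) (lik k w) bin).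
apply: etrans (congr1 (fun t => lik k w * t) e) _.
by rewrite mulrC -[X in X * _]mulrA -[LHS]mulrA.
Qed.

Lemma daniell_ufilter k : daniell (ufilter k).
Proof.
have mU : measurable_fun setT (U k : Om -> _) by exact: measurable_funPT.
exact: (daniell_pull (daniell_mul (daniell_Rintegral Poo) (bfun_lik k)) mU).
Qed.

Definition hit (e : R) j (w : Om) : R := \1_(box (y j.+1) e) (Y j.+1 w).

(** The conditional probability of [hit e j] given the signal path. *)
Definition hit_prob (e : R) j (w : Om) : R :=
  \int[lawG j]_x \1_(box (y j.+1) e) (x + H *m U j.+1 w).

Lemma bfun_past_hit e k l j : (j < k)%N -> (j < l)%N ->
  bfun (hit e j : past k l -> R).
Proof.
move=> jk jl.
exact: (bfun_comp (measurable_past_Y jk jl) (bfun_indic (measurable_box _ _))).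
Qed.

Lemma bfun_past_hit_prob e k l j : (j < k)%N -> bfun (hit_prob e j : past k l -> R).
Proof.
move=> jk.
have mD : measurable_fun setT (fun x : 'cV[R]_q * 'cV[R]_q => x.2 + x.1).
  by apply: measurable_addmx; [exact: measurable_snd|exact: measurable_fst].
have bD : bfun (fun x : 'cV[R]_q * 'cV[R]_q => \1_(box (y j.+1) e) (x.2 + x.1) : R).
  exact: (bfun_comp mD (bfun_indic (measurable_box (y j.+1) e))).
have mHU : measurable_fun setT (fun w : past k l => H *m U j.+1 w).
  by apply: measurable_mulmx; exact: measurable_past_U.
exact: (bfun_comp mHU (markov_bfun (markov_slice _ (lawG j)) bD)).
Qed.

(* Integrating out [eta l.+1], independent of the signal and of the earlier
   observation noises, replaces one indicator by a conditional probability. *)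
Lemma hit_integral e K f l : bfun f -> (l <= K)%N ->
  \int[P]_w (f (U K w) * (\prod_(0 <= j < l) hit e j w *
                          \prod_(l <= j < K) hit_prob e j w)) =
  \int[P]_w (f (U K w) * \prod_(0 <= j < K) hit_prob e j w).
Proof.
move=> bf; elim: l => [_|l IH lK].
  by apply: eq_Rintegral => w _; rewrite big_geq// mul1r.
rewrite -(IH (ltnW lK)).
(* Every factor but the one of index [l]; it depends on the signal and on [eta_1, ..., eta_l] only,
   hence not on [eta l.+1]. *)
pose W (w : past K l) := f (U K w) *
  (\prod_(0 <= j < l) hit e j w * \prod_(l.+1 <= j < K) hit_prob e j w).
have bW : bfun W.
  apply: bfunM; first exact: (bfun_comp (@measurable_past_U K l K (leqnn K))).
  apply: bfunM; apply: bfun_prod_nat => j /andP[j1 j2].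
    by apply: bfun_past_hit => //; exact: ltn_trans lK.
  exact: bfun_past_hit_prob.
pose h (x : past K l * 'cV[R]_q) : R :=
  W x.1 * \1_(box (y l.+1) e) (x.2 + H *m U l.+1 x.1).
have mHU : measurable_fun setT (fun x : past K l * 'cV[R]_q => x.2 + H *m U l.+1 x.1).
  apply: measurable_addmx; first exact: measurable_snd.
  apply: measurable_mulmx.
  by apply: (measurableT_comp _ measurable_fst); exact: measurable_past_U.
have bh : bfun h.
  apply: bfunM; first exact: (bfun_comp measurable_fst bW).
  exact: (bfun_comp mHU (bfun_indic (measurable_box _ _))).
transitivity (\int[P]_w h (w, eta l.+1 w)).
  apply: eq_Rintegral => w _; rewrite /h /W /hit/= big_nat_recr//= (signal_obs sigP).
  by rewrite [eta _ _ + _]addrC -!mulrA; congr (_ * (_ * _)); rewrite mulrC.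
have lP : inr l \notin noise_past K l by rewrite unfold_in/= ltnn.
rewrite (indep_integral FNm FNI FNT (signal_indep sigP) lP erefl bh).
apply: eq_Rintegral => w _.
have mb : measurable_fun setT (fun x : 'cV[R]_q => x + H *m U l.+1 w).
  by apply: measurable_addmx; [exact: measurable_id|exact: measurable_cst].
apply: etrans (bfun_RintegralZ (probability_ltoo (lawG l)) (W w)
  (bfun_comp mb (bfun_indic (measurable_box (y l.+1) e)))) _.
rewrite /W [\prod_(l <= j < K) _]big_ltn// -!mulrA; congr (_ * (_ * _)).
exact: mulrC.
Qed.

(** Each of the [K] boxes has volume [(2 / (n + 1))^q]. Divided by it, the hitting probability tends
    to the Gaussian density and stays below its peak, so dominated convergence applies. *)
Lemma hit_cvg K f : bfun f ->
  (\int[P]_w (f (U K w) * \prod_(0 <= j < K) hit n.+1%:R^-1 j w)) /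
    ((2 * n.+1%:R^-1) ^+ q) ^+ K @[n --> \oo] --> ufilter K f.
Proof.
move=> bf; pose v n : R := (2 * n.+1%:R^-1) ^+ q.
have n0 (n : nat) : 0 < n.+1%:R^-1 :> R by rewrite invr_gt0 ltr0n.
have v0 n : 0 < v n by rewrite exprn_gt0// mulr_gt0.
have mUK := @measurable_funPT _ _ _ _ (U K).
have bfU : bfun (fun w => f (U K w)) by exact: (bfun_comp mUK bf).
have [_ [c fc]] := bf.
pose g n w := f (U K w) * \prod_(0 <= j < K) (hit_prob n.+1%:R^-1 j w / v n).
have bhp n j : (j < K)%N -> bfun (hit_prob n.+1%:R^-1 j).
  by move=> jK; exact: (bfun_comp (@mid K 0) (bfun_past_hit_prob _ 0 jK)).
have bg n : bfun (g n).
  apply: (bfunM bfU); apply: bfun_prod_nat => j /andP[_ jK].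
  by apply: bfunM; [exact: bhp|exact: bfun_cst].
rewrite (_ : (fun n => _) = fun n => \int[P]_w g n w); last first.
  apply/funext => n; have := hit_integral n.+1%:R^-1 bf (leqnn K).
  under eq_Rintegral do rewrite [X in _ * (_ * X)]big_geq// mulr1.
  move=> ->; rewrite mulrC -(bfun_RintegralZ Poo); last first.
    by apply: (bfunM bfU); apply: bfun_prod_nat => j /andP[_ jK]; exact: bhp.
  apply: eq_Rintegral => w _; rewrite /g big_split/= prodr_const_nat subn0.
  by rewrite exprVn mulrC mulrA.
pose pk := gauss_peak (Gamma M).
have hb n j w : 0 <= hit_prob n.+1%:R^-1 j w / v n <= pk.
  exact: (gauss_box_bound (posdef_Gamma M) (@lawGE j)).
apply: (daniell_lim (daniell_Rintegral Poo) (c := c * pk ^+ K)) => //.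
- exact: bfunM bfU (bfun_lik K).
- move=> n w; rewrite /g normrM ler_pM//; rewrite normr_prod.
  rewrite -[K in leRHS]subn0 -prodr_const_nat; apply: ler_prod => j _.
  by have /andP[h1 h2] := hb n j w; rewrite normr_ge0 ger0_norm.
- move=> w; apply: cvgMl_tmp; apply: cvgr_prod => j.
  exact: (gauss_box_cvg (posdef_Gamma M) (@lawGE j)).
Qed.

End signal_process.

(** * From continuous to bounded measurable test functions *)

Section continuous_test_functions.
Context {R : realType} {p : nat}.

(** Sets whose indicators inherit, by bounded convergence, an identity known for continuous
    functions. Products of the approximations make this a pi-system. *)
Definition continuous_limits : set (set 'cV[R]_p) :=
  [set C | exists h : nat -> 'cV[R]_p -> R, [/\ forall n, continuous (h n),
    forall n, measurable_fun setT (h n), forall n x, `|h n x| <= 1 &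
    forall x, h n x @[n --> \oo] --> (\1_C x : R)]].

Lemma continuous_limits_measurable : continuous_limits `<=` measurable.
Proof.
move=> C [h [_ mh _ hC]].
by apply/(measurable_indicP R); exact: (measurable_fun_cvg mh (fun x _ => hC x)).
Qed.

Lemma continuous_limitsI : setI_closed continuous_limits.
Proof.
move=> C C' [h [ch mh h1 hC]] [h' [ch' mh' h1' hC']].
exists (fun n x => h n x * h' n x); split.
- by move=> n x; exact: (cvgM (ch n x) (ch' n x)).
- by move=> n; exact: measurable_funM.
- by move=> n x; rewrite normrM mulr_ile1.
- by move=> x; rewrite indicI; exact: cvgM.
Qed.

Lemma continuous_limitsT : continuous_limits setT.
Proof.
exists (fun _ _ => 1); split.
- by move=> n; exact: cst_continuous.
- by move=> n; exact: measurable_cst.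
- by move=> n x; rewrite normr1.
- by move=> x; rewrite indicT; exact: cvg_cst.
Qed.

Lemma continuous_limits_halfspace i (a : R) :
  continuous_limits [set x : 'cV[R]_p | x i 0 <= a].
Proof.
(* [exp (- 2 max (x_i - a, 0))] equals 1 on the half-space and is less than 1 off it, so its powers
   tend to the indicator. *)
pose g (x : 'cV[R]_p) := expR (- (`|x i 0 - a| + (x i 0 - a))).
have g0 x : 0 < g x by exact: expR_gt0.
have g1 x : g x <= 1.
  by rewrite -expR0 ler_expR oppr_le0 -lerBlDr sub0r -normrN ler_norm.
exists (fun n x => g x ^+ n); split.
- move=> n x.
  have c1 : (fun z : 'cV[R]_p => z i 0 - a) @ x --> x i 0 - a.
    exact: (cvgB (@coord_continuous R p 1 i 0 x) (cvg_cst a)).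
  have c2 : (fun z : 'cV[R]_p => `|z i 0 - a|) @ x --> `|x i 0 - a|.
    by have := cvg_norm c1; apply.
  have c3 : (fun z : 'cV[R]_p => - (`|z i 0 - a| + (z i 0 - a))) @ x -->
      - (`|x i 0 - a| + (x i 0 - a)).
    by have := cvgN (cvgD c2 c1); apply.
  have c4 : g z @[z --> x] --> g x := cvg_comp _ _ c3 (@continuous_expR R _).
  exact: (cvg_comp _ _ c4 (@exprn_continuous _ n _)).
- move=> n; apply: measurable_funX; apply: measurableT_comp; first exact: measurable_expR.
  apply: measurable_funN.
  have mx : measurable_fun setT (fun x : 'cV[R]_p => x i 0 - a).
    by apply: measurable_funB; [exact: measurable_mx_entry|exact: measurable_cst].
  by apply: measurable_funD => //; exact: measurableT_comp.
- move=> n x; rewrite normrX ger0_norm ?exprn_ile1//; exact: ltW.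
- move=> x; rewrite indicE; have [xa|xa] := leP (x i 0) a.
    rewrite mem_set// (_ : (fun n => _) = fun=> 1); first exact: cvg_cst.
    apply/funext => n; rewrite /g ler0_norm ?subr_le0// addNr oppr0 expR0 expr1n//.
  rewrite memNset/=; last by apply/negP; rewrite -ltNge.
  apply: cvg_expr; rewrite ger0_norm; last exact: ltW.
  rewrite -[ltRHS]expR0 ltr_expR oppr_lt0 addr_gt0 ?subr_gt0//.
  by rewrite normr_gt0 subr_eq0 gt_eqF.
Qed.

(** Complements of the half-spaces are the preimages of the rays that generate the Borel sets of
    each coordinate. *)
Lemma continuous_limitsE : @measurable _ 'cV[R]_p = <<s continuous_limits >>.
Proof.
apply/seteqP; split; last first.
  apply: smallest_sub; first exact: sigma_algebra_measurable.
  exact: continuous_limits_measurable.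
apply: smallest_sub; first exact: smallest_sigma_algebra.
move=> _ [[i j] [B [mB ->]]] /=.
suff me : measurable_fun setT
    ((fun A => A i j) : g_sigma_algebraType continuous_limits -> R).
  by have := me measurableT B mB; rewrite setTI.
move=> mT; apply: (measurability _ (RGenOInfty.measurableE R)) => //.
move=> /= _ [_ [a ->] <-]; rewrite setTI.
rewrite (_ : _ @^-1` _ = ~` [set x : 'cV[R]_p | x i 0 <= a]); last first.
  apply/seteqP; split => x /=; rewrite in_itv/= andbT (ord1 j) ltNge.
    by move/negP.
  by move=> /negP.
apply: (@measurableC _ (g_sigma_algebraType continuous_limits)).
by apply: sub_sigma_algebra; exact: continuous_limits_halfspace.
Qed.

End continuous_test_functions.

Section filter_identification.
Context {R : realType} {p q : nat} (M : model R p q) (K : nat).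
Context {d} {Om : measurableType d} (P : probability Om R).
Variables (U xi : nat -> {RV P >-> 'cV[R]_p}) (Y eta : nat -> {RV P >-> 'cV[R]_q}).
Hypothesis sigP : signal M U xi Y eta.
Variable mu : R.-pker 'M[R]_(q, K) ~> 'cV[R]_p.
Hypothesis filterP : filtering_distribution U Y mu.
Variable y : nat -> 'cV[R]_q.

Let Poo := probability_ltoo P.

Definition obs_box (e : R) : set 'M[R]_(q, K) :=
  [set A | forall j : 'I_K, box (y j.+1) e (col j A)].

Let Yp w := obs_path K (fun j => Y j w).

Lemma measurable_obs_path : measurable_fun setT Yp.
Proof.
apply: measurable_mxP => i j; rewrite /Yp; under eq_fun do rewrite mxE.
exact: (measurableT_comp (measurable_mx_entry i 0) (@measurable_funPT _ _ _ _ (Y j.+1))).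
Qed.

Lemma measurable_obs_box e : measurable (obs_box e).
Proof.
rewrite (_ : obs_box e = \bigcap_(j in setT) ((fun A : 'M[R]_(q, K) => col j A) @^-1` box (y j.+1) e)); last first.
  by apply/seteqP; split => A /= h j; [move=> _|]; exact: h.
apply: fin_bigcap_measurable => // j _.
have mc : measurable_fun setT (fun A : 'M[R]_(q, K) => col j A).
  apply: measurable_mxP => i l; under eq_fun do rewrite mxE.
  exact: measurable_mx_entry.
by rewrite -[X in measurable X]setTI; apply: mc => //; exact: measurable_box.
Qed.

Lemma prod_hit e w : \prod_(0 <= j < K) hit Y y e j w = \1_(obs_box e) (Yp w).
Proof.
have cE (j : 'I_K) : col j (Yp w) = Y j.+1 w.
  by apply/matrixP => i l; rewrite !mxE ord1.
rewrite big_mkord indicE; have [/set_mem h|/negP h] := boolP (_ \in _).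
  apply: big1 => j _; rewrite /hit indicE mem_set//.
  by have := h j; rewrite cE.
have [j jh] : exists j : 'I_K, ~ box (y j.+1) e (Y j.+1 w).
  apply: contrapT => /forallNP hj; apply: h; apply/mem_set => j.
  by rewrite cE; apply: contrapT; exact: hj.
by rewrite (bigD1 j)//= /hit indicE memNset// mul0r.
Qed.

Lemma markov_filter : markov_op (fun (f : 'cV[R]_p -> R) A => \int[mu A]_x f x).
Proof.
apply: markov_kernel; last by move=> A; exact: prob_kernel.
by move=> B mB; exact: measurable_kernel.
Qed.

Lemma filtering_integral (f : 'cV[R]_p -> R) B : bfun f -> measurable B ->
  \int[P]_w (f (U K w) * \1_B (Yp w)) =
  \int[P]_w ((\int[mu (Yp w)]_x f x) * \1_B (Yp w)).
Proof.
move=> bf mB; move: f bf.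
have bB : bfun (fun w => \1_B (Yp w) : R).
  exact: (bfun_comp measurable_obs_path (bfun_indic mB)).
have mYB : measurable (Yp @^-1` B).
  by rewrite -[X in measurable X]setTI; exact: measurable_obs_path.
have mUK := @measurable_funPT _ _ _ _ (U K).
have dB := daniell_mul (daniell_Rintegral Poo) bB.
apply: mclass_measurable.
  apply: mclass_eq; first exact: (daniell_pull dB mUK).
  exact: (daniell_markov (daniell_pull dB measurable_obs_path) markov_filter).
move=> A mA.
have mUA : measurable (U K @^-1` A) by rewrite -[X in measurable X]setTI; exact: mUK.
transitivity (fine (P (U K @^-1` A `&` Yp @^-1` B))).
  rewrite -Rintegral_indic; last exact: measurableI.
  by apply: eq_Rintegral => w _; rewrite indicI.
rewrite (filtering_cond_law filterP)//.
transitivity (\int[P]_w (\1_(Yp @^-1` B) w * fine (mu (Yp w) A))).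
  rewrite Rintegral_indic_mul /Rintegral; congr fine; apply: eq_integral => w _.
  exact: (prob_fineK (nu := fun w => mu (Yp w)) (fun w => prob_kernel _) w mA).
by apply: eq_Rintegral => w _; rewrite Rintegral_indic// mulrC.
Qed.

(** On a small box around the record, weak continuity keeps [\int[mu Y] f] within [eps] of its value
    at the record. Hence the averages of [f (U K)] and of 1 over the box, divided by its volume, are
    proportional up to [eps], and [hit_cvg] gives their limits. The product form needs no positivity
    of [ufilter] at 1. *)
Lemma filter_continuous_eq (f : 'cV[R]_p -> R) : bfun f -> continuous f ->
  ufilter M U y K (fun=> 1) * \int[mu (obs_path K y)]_x f x = ufilter M U y K f.
Proof.
move=> bf cf; set y0 := obs_path K y; set g0 := \int[mu y0]_x f x.
pose v n : R := ((2 * n.+1%:R^-1) ^+ q) ^+ K.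
have v0 n : 0 < v n by rewrite !exprn_gt0// mulr_gt0 ?invr_gt0 ?ltr0n.
pose a (f : 'cV[R]_p -> R) n := \int[P]_w (f (U K w) * \1_(obs_box n.+1%:R^-1) (Yp w)) / v n.
have ac h : bfun h -> a h n @[n --> \oo] --> ufilter M U y K h.
  move=> bh; rewrite (_ : a h = fun n =>
      (\int[P]_w (h (U K w) * \prod_(0 <= j < K) hit Y y n.+1%:R^-1 j w)) / v n).
    exact: hit_cvg sigP _ _ _ bh.
  apply/funext => n; rewrite /a; congr (_ / _).
  by apply: eq_Rintegral => w _; rewrite prod_hit.
have b1 : bfun (fun _ : 'cV[R]_p => 1 : R) := bfun_cst 1.
have c1 := ac _ b1; have cF := ac _ bf.
have cd : a f n - a (fun=> 1) n * g0 @[n --> \oo] -->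
    ufilter M U y K f - ufilter M U y K (fun=> 1) * g0.
  by apply: cvgB => //; exact: cvgMr_tmp.
have a1 n : 0 <= a (fun=> 1) n.
  rewrite divr_ge0//; last exact: ltW.
  by apply: Rintegral_ge0 => w _; rewrite mul1r indicE.
have z0 : 0 <= ufilter M U y K (fun=> 1).
  by apply: (ler_cvg_to (cvg_cst 0) c1); exact: nearW.
suff H (eps : R) : 0 < eps ->
    `|ufilter M U y K f - ufilter M U y K (fun=> 1) * g0| <=
    eps * ufilter M U y K (fun=> 1).
  apply/eqP; rewrite eq_sym -subr_eq0 -normr_le0; apply/ler_addgt0Pl => e e0.
  (* The added 1 keeps the divisor positive, as the mass is only known to be nonnegative here. *)
  rewrite addr0; apply: le_trans (H (e / (ufilter M U y K (fun=> 1) + 1)) _) _.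
    by rewrite divr_gt0// ltr_wpDl.
  by rewrite mulrAC ler_pdivrMr ?ltr_wpDl// ler_pM2l// lerDl.
move=> eps0.
have cg := filtering_continuous filterP cf.
have [_ [c fc]] := bf.
have /cvgrPdist_le/(_ _ eps0)/nbhs_ballP[r /= r0 rh] := cg (ex_intro _ c fc) y0.
apply: (ler_cvg_to (cvg_norm cd) (cvgMl_tmp c1)).
near=> n.
have nr : n.+1%:R^-1 < r by near: n; exact: near_infty_natSinv_lt (PosNum r0).
have mb := measurable_obs_box n.+1%:R^-1.
have bB : bfun (fun w => \1_(obs_box n.+1%:R^-1) (Yp w) : R).
  exact: (bfun_comp measurable_obs_path (bfun_indic mb)).
have bmu : bfun (fun w => \int[mu (Yp w)]_x f x).
  exact: (bfun_comp measurable_obs_path (markov_bfun markov_filter bf)).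
rewrite /a (filtering_integral bf mb).
under [X in _ - X / _ * _]eq_Rintegral do rewrite mul1r.
under [X in _ <= _ * (X / _)]eq_Rintegral do rewrite mul1r.
set If := \int[P]_w (_ * _); set I1 := \int[P]_w \1_(_) _.
have near_g0 w : obs_box n.+1%:R^-1 (Yp w) -> `|g0 - \int[mu (Yp w)]_x f x| <= eps.
  move=> hw; apply: rh; split => // i j /=.
  have := hw j i; rewrite !mxE /ball/= distrC => h; exact: lt_trans nr.
have lo : (g0 - eps) * I1 <= If.
  rewrite -(bfun_RintegralZ Poo)//; apply: (bfun_le_Rintegral Poo); [exact: bfunZ|exact: bfunM|].
  move=> w; rewrite indicE; have [/set_mem/near_g0|_] := boolP (_ \in _); last by rewrite !mulr0.
  by rewrite !mulr1 ler_distlC => /andP[].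
have hi : If <= (g0 + eps) * I1.
  rewrite -(bfun_RintegralZ Poo)//; apply: (bfun_le_Rintegral Poo); [exact: bfunM|exact: bfunZ|].
  move=> w; rewrite indicE; have [/set_mem/near_g0|_] := boolP (_ \in _); last by rewrite !mulr0.
  by rewrite !mulr1 ler_distlC => /andP[].
rewrite mulrAC -mulrBl normrM [X in _ * X]ger0_norm; last by rewrite invr_ge0 ltW.
rewrite mulrA ler_pM2r ?invr_gt0// ler_norml; apply/andP; split; lra.
Unshelve. all: by end_near. Qed.

Lemma filter_eq (f : 'cV[R]_p -> R) : bfun f ->
  ufilter M U y K (fun=> 1) * \int[mu (obs_path K y)]_x f x = ufilter M U y K f.
Proof.
have muoo : (mu (obs_path K y) setT < +oo)%E by rewrite prob_kernel ltry.
have mV : mclass (fun f => ufilter M U y K (fun=> 1) * \int[mu (obs_path K y)]_x f x =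
    ufilter M U y K f).
  by apply: mclass_eq; [exact/daniellZ/daniell_Rintegral|exact: daniell_ufilter sigP _ _].
move: f; apply: (mclass_pi mV continuous_limitsE).
- exact: continuous_limitsI.
- exact: continuous_limitsT.
- move=> C CC; have mC := continuous_limits_measurable CC.
  have [h [ch mh h1 hC]] := CC.
  have bh n : bfun (h n) by split; [exact: mh|exists 1].
  apply: (mclass_lim mV bh (bfun_indic mC) h1 hC) => n.
  exact: filter_continuous_eq.
Qed.

End filter_identification.

(** * The lower bound [kappa] on the weights *)

Section weight_bound.
Context {R : realType} {p q : nat} (M : model R p q) (K : nat) (y : nat -> 'cV[R]_q).

Lemma kappa_gt0 : 0 < kappa M K y. Proof. by rewrite invr_gt0 expR_gt0. Qed.

(** Boundedness of [psi] makes the set bounded above, so that [sup] is a true supremum and not a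
    default value. *)
Lemma sup_wnorm_ge v : wnorm (Smx M) (obsop M *m psi M v) ^+ 2 <=
  sup [set wnorm (Smx M) (obsop M *m psi M v) ^+ 2 | v in setT].
Proof.
have [c psic] := psi_bounded M.
have [e ec] := qform_bounded ((obsop M)^T *m invmx (Smx M) *m obsop M) c.
apply: ub_le_sup; last by exists v.
exists e => _ [x _ <-]; rewrite wnorm_sqr; last exact: posdef_Smx.
by have := ec _ (psic x); rewrite /qform trmx_mul !mulmxA.
Qed.

(** Origin of [kappa]: the parallelogram law gives [|a - b|^2 <= 2 |a|^2 + 2 |b|^2], and the 1/2 in
    the exponent of the weight cancels the 2. *)
Lemma kappa_le_ws k v : (k < K)%N -> kappa M K y <= ws M y k v.
Proof.
move=> kK; rewrite /kappa /ws -expRN ler_expR lerN2.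
have pS := posdef_Smx M; have pSi := posdef_inv pS.
have h1 : wnorm (Smx M) (y k.+1) ^+ 2 <=
    \big[Num.max/0]_(j < K) (wnorm (Smx M) (y j.+1) ^+ 2).
  exact: (le_bigmax _ (fun j : 'I_K => wnorm (Smx M) (y j.+1) ^+ 2) (Ordinal kK)).
have h2 := sup_wnorm_ge v.
have := qform_parallelogram (invmx (Smx M)) (y k.+1) (obsop M *m psi M v).
have := posdef_ge0 (y k.+1 + obsop M *m psi M v) pSi.
rewrite -!(wnorm_sqr _ pS) => h3 h4; lra.
Qed.

Lemma kappa_le1 : (0 < K)%N -> kappa M K y <= 1.
Proof.
move=> K0; apply: le_trans (kappa_le_ws 0 K0) _.
exact: expR_wnorm_le1.
Qed.

End weight_bound.

Section dist_bound.
Context {R : realType} {d d'} {Om : measurableType d} {T : measurableType d'}.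
Variable P : probability Om R.

Lemma dist_le (mu nu : Om -> {measure set T -> \bar R}) (e : R) : 0 <= e ->
  (forall f, bfun f -> (forall x, `|f x| <= 1) ->
    bfun (fun w => \int[mu w]_x f x - \int[nu w]_x f x) /\
    \int[P]_w ((\int[mu w]_x f x - \int[nu w]_x f x) ^+ 2) <= e ^+ 2) ->
  (dist P mu nu <= e%:E)%E.
Proof.
move=> e0 H; apply: ub_ereal_sup => _ [f [mf f1] <-].
have [bD le] := H f (conj mf (ex_intro _ 1 f1)) f1.
have bD2 : bfun (fun w => `|\int[mu w]_x f x - \int[nu w]_x f x| ^+ 2).
  by under eq_fun do rewrite real_normK ?num_real//; exact: bfunM.
rewrite unlock (bfun_RintegralE (probability_ltoo P) bD2)/= lee_fin.
rewrite -(ger0_norm e0) -sqrtr_sqr ler_wsqrtr//.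
by under eq_Rintegral do rewrite real_normK ?num_real//.
Qed.

End dist_bound.

(** * The normalized filter and the error recursion *)

Section normalized_filter.
Context {R : realType} {p q : nat} (M : model R p q) (K N : nat).
Hypotheses (K_gt0 : (0 < K)%N) (N_gt0 : (0 < N)%N).
Context {d1} {Om : measurableType d1} (P : probability Om R).
Variables (U xi : nat -> {RV P >-> 'cV[R]_p}) (Y eta : nat -> {RV P >-> 'cV[R]_q}).
Hypothesis sigP : signal M U xi Y eta.
Variable y : nat -> 'cV[R]_q.
Context {d2} {Om' : measurableType d2} (P' : probability Om' R).
Variables (u zeta : nat -> 'I_N -> {RV P' >-> 'cV[R]_p}).
Hypothesis opfP : optimal_particle_filter M y u zeta K.

Let Poo := probability_ltoo P.
Let gCE := gCE K_gt0 N_gt0 opfP.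
Local Notation kap := (kappa M K y).
Local Notation one := (fun _ : 'cV[R]_p => 1 : R).

Lemma lik_ge0 k w : 0 <= lik M U y k w.
Proof. by apply: prodr_ge0 => j _; exact: gauss_pdf_ge0. Qed.

Lemma update_cst_pos : 0 < update_cst M.
Proof. exact: (update_cst_gt0 (lawSE sigP 0) gCE (lawGE sigP 0)). Qed.

Lemma ufilter_one_S k : ufilter M U y k.+1 one =
  update_cst M * ufilter M U y k (ws M y k).
Proof.
apply: etrans (ufilterS sigP y gCE k (bfun_cst 1)) _.
congr (_ * ufilter _ _ _ _ _); apply/funext => v.
rewrite Rintegral_cst// mul1r -[RHS]mulr1; congr (_ * _).
exact: (congr1 fine (probability_setT _)).
Qed.

Lemma ufilter_ws_ge k : (k < K)%N ->
  kap * ufilter M U y k one <= ufilter M U y k (ws M y k).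
Proof.
move=> kK; have bl := bfun_lik sigP y k.
have mU := @measurable_funPT _ _ _ _ (U k).
have bw := bfun_comp mU (bfun_ws M y k).
rewrite /ufilter -(bfun_RintegralZ Poo); last exact: bfunM (bfun_cst 1) bl.
apply: (bfun_le_Rintegral Poo).
- exact: bfunZ (bfunM (bfun_cst 1) bl).
- exact: bfunM bw bl.
- by move=> w; rewrite mul1r ler_wpM2r ?lik_ge0// kappa_le_ws.
Qed.

(** Each step multiplies the mass by at least [update_cst M * kap], starting from 1. *)
Lemma ufilter_one_gt0 k : (k <= K)%N -> 0 < ufilter M U y k one.
Proof.
elim: k => [_|k IH kK].
  rewrite (ufilter0 sigP y (bfun_cst 1)) Rintegral_cst// mul1r.
  by rewrite (_ : fine _ = 1)//; exact: (congr1 fine (probability_setT _)).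
rewrite ufilter_one_S mulr_gt0 ?update_cst_pos//.
apply: lt_le_trans (ufilter_ws_ge kK).
by rewrite mulr_gt0 ?kappa_gt0// IH// ltnW.
Qed.

(** Stands for the filter at every step [k]; a kernel [mu] to compare it with is given at time [K]
    only. *)
Definition nfilter k f := ufilter M U y k f / ufilter M U y k one.

Lemma nfilterS k f : (k < K)%N -> bfun f -> nfilter k.+1 f =
  nfilter k (fun v => ws M y k v * propagate M N_gt0 y zeta k f v) /
  nfilter k (ws M y k).
Proof.
move=> kK bf; rewrite /nfilter ufilter_one_S (ufilterS sigP y gCE k bf).
have c0 : update_cst M != 0 by rewrite gt_eqF// update_cst_pos.
have u0 : ufilter M U y k one != 0 by rewrite gt_eqF// ufilter_one_gt0// ltnW.
have w0 : ufilter M U y k (ws M y k) != 0.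
  rewrite gt_eqF//; apply: lt_le_trans (ufilter_ws_ge kK).
  by rewrite mulr_gt0 ?kappa_gt0 ?ufilter_one_gt0// ltnW.
by field; rewrite c0 u0 w0.
Qed.

Lemma nfilter_ws_ge k : (k < K)%N -> kap <= nfilter k (ws M y k).
Proof.
by move=> kK; rewrite ler_pdivlMr ?ufilter_ws_ge// ufilter_one_gt0// ltnW.
Qed.

Let s : R := (Num.sqrt N%:R)^-1.

Definition err_bound k : R := \sum_(1 <= j < k.+1) (2 * kap ^- 2) ^+ j * s.

Lemma err_bound_ge0 k : 0 <= err_bound k.
Proof.
apply: sumr_ge0 => j _; rewrite mulr_ge0 ?invr_ge0 ?sqrtr_ge0//.
by rewrite exprn_ge0// mulr_ge0// invr_ge0 sqr_ge0.
Qed.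

(** Factoring [2 kap^-2] out of the right side leaves [s + err_bound k]; the passage from [kap^-1]
    to [kap^-2] is [kap <= 1]. *)
Lemma err_boundS k : 2 * kap^-1 * (err_bound k + s) <= err_bound k.+1.
Proof.
rewrite {2}/err_bound big_nat_recl// expr1.
have -> : \sum_(1 <= i < k.+1) (2 * kap ^- 2) ^+ i.+1 * s =
    (2 * kap ^- 2) * err_bound k.
  by rewrite /err_bound mulr_sumr; apply: eq_bigr => i _; rewrite exprS mulrA.
rewrite -mulrDr addrC ler_wpM2r//.
  by rewrite addr_ge0 ?err_bound_ge0// invr_ge0 sqrtr_ge0.
rewrite ler_pM2l// -exprVn expr2 ler_peMl ?invr_ge0 ?(ltW (kappa_gt0 _ _ _))//.
by rewrite invf_ge1 ?kappa_gt0// kappa_le1.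
Qed.

Lemma opf_l2err k : (k <= K)%N -> l2err M y u zeta k (nfilter k) (err_bound k).
Proof.
elim: k => [_|k IH kK].
  move=> f bf f1.
  have m1 : ufilter M U y 0 one = 1.
    rewrite (ufilter0 sigP y (bfun_cst 1)) Rintegral_cst// mul1r.
    exact: (congr1 fine (probability_setT _)).
  rewrite /nfilter m1 divr1 (ufilter0 sigP y bf).
  under eq_Rintegral do rewrite subrr expr0n.
  by rewrite Rintegral_cst// mul0r sqr_ge0.
have h := l2err_step K_gt0 opfP kK (err_bound_ge0 k) (kappa_gt0 M K y) (IH (ltnW kK))
  (nfilter_ws_ge kK) (fun f => @nfilterS k f kK).
move=> f bf f1; apply: le_trans (h f bf f1) _.
rewrite ler_pXn2r ?nnegrE ?err_bound_ge0 ?err_boundS//.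
by rewrite mulr_ge0 ?addr_ge0 ?err_bound_ge0 ?mulr_ge0 ?invr_ge0 ?sqrtr_ge0.
Qed.

End normalized_filter.

Theorem corollary6p8 (R : realType) (p q : nat) (M : model R p q) (K N : nat)
    (K_gt0 : (0 < K)%N) (N_gt0 : (0 < N)%N)
    (d1 : measure_display) (Om : measurableType d1) (P : probability Om R)
    (U xi : nat -> {RV P >-> 'cV[R]_p}) (Y eta : nat -> {RV P >-> 'cV[R]_q})
    (signalP : signal M U xi Y eta)
    (mu : R.-pker 'M[R]_(q, K) ~> 'cV[R]_p)
    (filterP : filtering_distribution U Y mu)
    (y : nat -> 'cV[R]_q)
    (d2 : measure_display) (Om' : measurableType d2) (P' : probability Om' R)
    (u zeta : nat -> 'I_N -> {RV P' >-> 'cV[R]_p})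
    (opfP : optimal_particle_filter M y u zeta K) :
  (dist P' (opf_weighted M y u zeta K) (fun=> mu (obs_path K y)) <=
   (\sum_(1 <= k < K.+1)
      (2 * kappa M K y ^- 2) ^+ k * (Num.sqrt N%:R)^-1)%:E)%E /\
  (dist P' (opf_resampled u K) (fun=> mu (obs_path K y)) <=
   (\sum_(0 <= k < K.+1)
      (2 * kappa M K y ^- 2) ^+ k * (Num.sqrt N%:R)^-1)%:E)%E.
Proof.
have err := opf_l2err K_gt0 N_gt0 signalP opfP (leqnn K).
have e0 := err_bound_ge0 M K N y K.
have muE f : bfun f -> \int[mu (obs_path K y)]_x f x = nfilter M U y K f.
  move=> bf; rewrite /nfilter -(filter_eq signalP filterP y bf) mulrAC divff ?mul1r//.
  by rewrite gt_eqF// (ufilter_one_gt0 K_gt0 N_gt0 signalP opfP).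
split.
  apply: dist_le => // f bf f1; split.
    apply: bfunB; last exact: bfun_cst.
    exact: bfun_opf_op.
  rewrite muE//; exact: err.
(* The extra term [k = 0] is [N^-1/2], the cost of the final resampling. *)
rewrite big_ltn// expr0 mul1r.
apply: dist_le; first by rewrite addr_ge0// invr_ge0 sqrtr_ge0.
move=> f bf f1; split.
  apply: bfunB; last exact: bfun_cst.
  rewrite (_ : (fun w => _) = fun w => \sum_(n < N) N%:R^-1 * f (u K n w)).
    apply: bfun_sum => n; apply: bfunZ.
    exact: (bfun_comp (@measurable_funPT _ _ _ _ (u K n)) bf).
  by apply/funext => w; rewrite Rintegral_wdirac.
rewrite muE//; exact: l2err_resampled (leqnn K) e0 err bf f1.
Qed.
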